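(* Let $\alpha>0$, let $E\subset\mathbb{T}^n$ be a closed set of balanced Hausdorff dimension $c$, and let $f\in I_{A_\alpha}(E)$ be such that $|f(x)|\le A\,d(x,E)^m$ for any $x\in\mathbb{T}^n$ and some $A>0$, $m>0$. If $m>c/2+\alpha$ or $m=c/2+\alpha=n/2+\alpha$, then $f\in J_{A_\alpha}(E)$.
   Context: $\mathbb{T}^n$ is the $n$-dimensional torus with its natural metric $d$, and $d(x,E)=\inf_{y\in E}d(x,y)$. $A_\alpha(\mathbb{T}^n)$ is the weighted Fourier algebra of functions $f\in C(\mathbb{T}^n)$ such that $f(t)=\sum_{k\in\mathbb{Z}^n}a_ke^{ik\cdot t}$ with $\|f\|_{A_\alpha}=\sum_{k\in\mathbb{Z}^n}|a_k|(1+|k|)^\alpha<\infty$, where $k\cdot t=k_1t_1+\dots+k_nt_n$ and $|k|=(k_1^2+\dots+k_n^2)^{1/2}$. For closed $E\subset\mathbb{T}^n$: $I_{A_\alpha}(E)=\{f\in A_\alpha(\mathbb{T}^n):f=0\text{ on }E\}$, and $J_{A_\alpha}(E)$ is the closure in $A_\alpha(\mathbb{T}^n)$ of $\{f\in A_\alpha(\mathbb{T}^n):f=0\text{ in a neighborhood of }E\}$. The balanced Hausdorff dimension $bh(E)$ is the infimum of all positive numbers $c$ with the following property: there exist constants $N,P>0$ such that for all sufficiently small $\delta>0$ there is a finite covering $E\subset\bigsqcup_{j=1}^m\beta_j$ by pairwise disjoint sets $\beta_j\subset\mathbb{T}^n$ satisfying (i) $\delta/P<\operatorname{diam}\beta_j<\delta$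 for all $1\le j\le m$, and (ii) $\sum_{j=1}^m(\operatorname{diam}\beta_j)^c\le N$. *)

(* Defs.v *)
From HB Require Import structures.
From mathcomp Require Import all_boot all_order all_algebra generic_quotient.
From mathcomp Require Import all_classical all_reals all_analysis.
From mathcomp Require Import showcase.summability.
From mathcomp Require Import complex ring lra.

Set Implicit Arguments.
Unset Strict Implicit.
Unset Printing Implicit Defensive.
Import Order.TTheory GRing.Theory Num.Theory.
Import numFieldNormedType.Exports.

Local Open Scope classical_set_scope.
Local Open Scope ring_scope.
Local Open Scope quotient_scope.

Definition enorm (R : realType) (n : nat) (x : 'rV[R]_n) : R :=
  Num.sqrt (\sum_(i < n) x 0 i ^+ 2).

Section EuclideanNorm.
Context (R : realType) (n : nat).
Implicit Types x y z : 'rV[R]_n.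

Lemma enorm_ge0 x : 0 <= enorm x. Proof. exact: sqrtr_ge0. Qed.

Lemma sqr_enorm x : enorm x ^+ 2 = \sum_(i < n) x 0 i ^+ 2.
Proof. by rewrite sqr_sqrtr// sumr_ge0// => i _; rewrite sqr_ge0. Qed.

Lemma enorm0 : enorm (0 : 'rV[R]_n) = 0.
Proof. by rewrite /enorm big1 ?sqrtr0// => i _; rewrite mxE expr0n. Qed.

Lemma enormN x : enorm (- x) = enorm x.
Proof. by congr Num.sqrt; apply: eq_bigr => i _; rewrite mxE sqrrN. Qed.

Lemma enorm_coord x i : `|x 0 i| <= enorm x.
Proof.
rewrite -sqrtr_sqr ler_sqrt; last by rewrite sumr_ge0// => j _; rewrite sqr_ge0.
by rewrite (bigD1 i)//= lerDl sumr_ge0// => j _; rewrite sqr_ge0.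
Qed.

Lemma enorm_CS x y : \sum_(i < n) x 0 i * y 0 i <= enorm x * enorm y.
Proof.
apply: le_trans (ler_norm _) _.
rewrite -(@ler_pXn2r _ 2)// ?nnegrE ?mulr_ge0 ?enorm_ge0//.
rewrite exprMn !sqr_enorm real_normK ?num_real//.
have : 0 <= \sum_(i < n) \sum_(j < n) (x 0 i * y 0 j - x 0 j * y 0 i) ^+ 2.
  by apply: sumr_ge0 => i _; apply: sumr_ge0 => j _; rewrite sqr_ge0.
have -> : \sum_(i < n) \sum_(j < n) (x 0 i * y 0 j - x 0 j * y 0 i) ^+ 2 =
  (\sum_i x 0 i ^+ 2) * (\sum_j y 0 j ^+ 2)
  + (\sum_i y 0 i ^+ 2) * (\sum_j x 0 j ^+ 2)
  - 2 * ((\sum_i x 0 i * y 0 i) * (\sum_j x 0 j * y 0 j)).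
  rewrite !mulr_suml mulr_sumr -big_split -sumrB/=; apply: eq_bigr => i _.
  rewrite !mulr_sumr -big_split -sumrB/=; apply: eq_bigr => j _; ring.
rewrite expr2; nra.
Qed.

Lemma enormD x y : enorm (x + y) <= enorm x + enorm y.
Proof.
rewrite -(@ler_pXn2r _ 2)// ?nnegrE ?addr_ge0 ?enorm_ge0//.
rewrite sqrrD !sqr_enorm.
have -> : \sum_(i < n) (x + y) 0 i ^+ 2 =
  \sum_i x 0 i ^+ 2 + (\sum_i x 0 i * y 0 i) *+ 2 + \sum_i y 0 i ^+ 2.
  rewrite -sumrMnl -!big_split/=; apply: eq_bigr => i _.
  by rewrite mxE sqrrD.
by rewrite lerD2r lerD2l lerMn2r/= enorm_CS.
Qed.

Lemma enorm_eq0 x : enorm x = 0 -> x = 0.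
Proof.
move=> x0; apply/rowP => i; rewrite mxE; apply/eqP; rewrite -normr_le0 -x0.
exact: enorm_coord.
Qed.

End EuclideanNorm.

Section Torus.
Context (R : realType) (n : nat).

Definition latt (k : 'rV[int]_n) : 'rV[R]_n := (2 * pi) *: map_mx intr k.

Definition torus_eq (x y : 'rV[R]_n) : bool := `[< exists k, x = y + latt k >].

Lemma latt0 : latt 0 = 0. Proof. by rewrite /latt map_mx0 scaler0. Qed.
Lemma lattN k : latt (- k) = - latt k.
Proof. by rewrite /latt map_mxN scalerN. Qed.
Lemma lattD k l : latt (k + l) = latt k + latt l.
Proof. by rewrite /latt map_mxD scalerDr. Qed.

Lemma torus_eq_refl : reflexive torus_eq.
Proof. by move=> x; apply/asboolP; exists 0; rewrite latt0 addr0. Qed.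
Lemma torus_eq_sym : symmetric torus_eq.
Proof.
have H x y : torus_eq x y -> torus_eq y x.
  by move=> /asboolP[k ->]; apply/asboolP; exists (- k); rewrite lattN addrK.
by move=> x y; apply/idP/idP; apply: H.
Qed.
Lemma torus_eq_trans : transitive torus_eq.
Proof.
move=> y x z /asboolP[k ->] /asboolP[l ->]; apply/asboolP; exists (l + k).
by rewrite lattD addrA.
Qed.
Canonical torus_eq_equiv :=
  EquivRel torus_eq torus_eq_refl torus_eq_sym torus_eq_trans.

(* R^n / (2 pi Z)^n *)
Definition torus : Type := {eq_quot torus_eq}.
HB.instance Definition _ := Choice.on torus.
HB.instance Definition _ := EqQuotient.on torus.

(* quotient of the Euclidean metric of R^n *)
Definition torus_dist (x y : torus) : R :=
  inf [set enorm (repr x - repr y + latt k) | k in [set: 'rV[int]_n]].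

Let S (x y : torus) :=
  [set enorm (repr x - repr y + latt k) | k in [set: 'rV[int]_n]].

Let S_inf x y : has_inf (S x y).
Proof.
split; first by exists (enorm (repr x - repr y + latt 0)), 0.
by exists 0 => _ [k _ <-]; exact: enorm_ge0.
Qed.

Let dist_le x y k : torus_dist x y <= enorm (repr x - repr y + latt k).
Proof. by apply: ge_inf; [case: (S_inf x y)|exists k]. Qed.

Let dist_ex x y (e : R) : 0 < e ->
  exists k, enorm (repr x - repr y + latt k) < torus_dist x y + e.
Proof. by move=> /inf_adherent /(_ (S_inf x y))[_ [k _ <-] ?]; exists k. Qed.

Let dist_ge0 x y : 0 <= torus_dist x y.
Proof.
by apply: lb_le_inf; [case: (S_inf x y)|move=> _ [k _ <-]; exact: enorm_ge0].
Qed.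

Let distxx x : torus_dist x x = 0.
Proof.
apply/eqP; rewrite eq_le dist_ge0 andbT (le_trans (dist_le x x 0))//.
by rewrite latt0 addr0 subrr enorm0.
Qed.

Let dist_sym x y : torus_dist x y = torus_dist y x.
Proof.
have H u v : torus_dist u v <= torus_dist v u.
  apply: lb_le_inf; first by case: (S_inf v u).
  move=> _ [k _ <-]; rewrite -enormN opprD opprB -lattN; exact: dist_le.
by apply/eqP; rewrite eq_le !H.
Qed.

Let dist_triangle y x z : torus_dist x z <= torus_dist x y + torus_dist y z.
Proof.
apply/ler_addgt0Pr => e e0.
have [k kP] := dist_ex x y (divr_gt0 e0 (ltr0Sn _ 1)).
have [l lP] := dist_ex y z (divr_gt0 e0 (ltr0Sn _ 1)).
have := dist_le x z (k + l).
have -> : repr x - repr z + latt (k + l) =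
    (repr x - repr y + latt k) + (repr y - repr z + latt l).
  by rewrite lattD [RHS]addrACA [_ - _ + (_ - _)]addrA subrK.
move=> /le_trans -/(_ _ (enormD _ _)) H; lra.
Qed.

Let latt_discrete k : enorm (latt k) < 2 -> k = 0.
Proof.
move=> k2; apply/rowP => i; rewrite mxE.
have := le_lt_trans (enorm_coord (latt k) i) k2.
rewrite !mxE normrM; set p := `|2 * pi|.
have p2 : 2 <= p.
  by rewrite /p ger0_norm ?mulr_ge0 ?pi_ge0// ler_peMr// (le_trans _ (pi_ge2 R))// ler1n.
rewrite -intr_norm => H.
have : (`|k 0 i|%:~R : R) < 1.
  rewrite ltNge; apply/negP => H1.
  by move: H; rewrite ltNge (le_trans p2)// ler_peMr// normr_ge0.
by rewrite -[1]/(1%:~R) ltr_int; case: (k 0 i) => [[|m]|m].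
Qed.

Let dist_pos x y : torus_dist x y = 0 -> x = y.
Proof.
move=> xy0.
have [k k1] := dist_ex x y ltr01.
suff k0 : enorm (repr x - repr y + latt k) = 0.
  rewrite -[x]reprK -[y]reprK; apply/eqmodP; apply/asboolP; exists (- k).
  rewrite lattN; apply/eqP; rewrite -subr_eq0 opprD opprK addrA.
  exact/eqP/enorm_eq0.
apply/eqP; rewrite eq_le enorm_ge0 andbT; apply/ler_addgt0Pr => e e0.
rewrite add0r.
have m0 : 0 < Num.min e 1 by rewrite lt_min e0 ltr01.
have [l] := dist_ex x y m0; rewrite xy0 add0r lt_min => /andP[le l1].
suff -> : k = l by exact: ltW.
apply/eqP; rewrite -subr_eq0; apply/eqP/latt_discrete.
have -> : latt (k - l) =
    (repr x - repr y + latt k) + - (repr x - repr y + latt l).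
  by rewrite lattD lattN [in RHS]opprD addrACA subrr add0r.
move: (enormD (repr x - repr y + latt k) (- (repr x - repr y + latt l))).
rewrite enormN; move: k1; rewrite xy0 add0r; lra.
Qed.

HB.instance Definition _ := @isMetric.Build R torus
  torus_dist distxx dist_pos dist_sym dist_triangle.

End Torus.

Section MetricNotions.
Context (R : realType) (T : metricType R).

(* inf set0 = +oo *)
Definition dist_to (x : T) (E : set T) : \bar R :=
  ereal_inf [set (mdist x y)%:E | y in E].

(* Real-valued, hence meaningful for bounded B only; the torus is bounded. *)
Definition diam (B : set T) : R := sup [set mdist x y | x in B & y in B].

Definition balanced_covers (E : set T) (c : R) : Prop :=
  exists N P : R, [/\ 0 < N, 0 < P &
    \forall delta \near 0^'+, exists (q : nat) (beta : 'I_q -> set T),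
      [/\ trivIset [set: 'I_q] beta,
          E `<=` \bigcup_j beta j,
          forall j, delta / P < diam (beta j) < delta &
          \sum_(j < q) diam (beta j) `^ c <= N]].

Definition bh_dim (E : set T) : \bar R :=
  ereal_inf [set c%:E | c in [set c | 0 < c /\ balanced_covers E c]].

End MetricNotions.

Section WeightedFourierAlgebra.
Context (R : realType) (n : nat).
Implicit Types (f g : torus R n -> R[i]) (a : 'rV[int]_n -> R[i]).
Implicit Types (alpha : R) (E : set (torus R n)).

(* e^{i k.t}; since k is integral, the value does not depend on the
   representative of t. *)
Definition character (k : 'rV[int]_n) (t : torus R n) : R[i] :=
  let theta := \sum_(j < n) (k 0 j)%:~R * repr t 0 j in
  (cos theta +i* sin theta)%C.

(* Unconditional pointwise convergence of sum_k a_k e^{i k.t} to f(t), i.e.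
   along the net of finite subsets of Z^n. R[i] carries its topology through
   the alias R[i]^o. *)
Definition fourier_series a f : Prop := forall t,
  partial_sum (fun k => a k * character k t : R[i]^o) @ totally
    --> (f t : R[i]^o).

Definition weighted_l1 alpha a : \bar R :=
  (\esum_(k in [set: 'rV[int]_n])
    (Normc.normc (a k) * (1 + enorm (map_mx intr k : 'rV[R]_n)) `^ alpha)%:E)%E.

Definition A_alg alpha : set (torus R n -> R[i]) :=
  [set f | continuous (f : torus R n -> R[i]^o) /\
           exists2 a, fourier_series a f & (weighted_l1 alpha a < +oo)%E].

(* The a with fourier_series a f is unique if it exists: unconditional
   convergence at t is absolute, so the a_k are the Fourier coefficients of f.
   For f in A_alg alpha this is therefore the family used there. *)
Definition fourier_coef f : 'rV[int]_n -> R[i] :=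
  xget (fun=> 0) [set a | fourier_series a f].

Definition A_norm alpha f : \bar R := weighted_l1 alpha (fourier_coef f).

Definition A_closure alpha (F : set (torus R n -> R[i])) :
    set (torus R n -> R[i]) :=
  [set f | A_alg alpha f /\ forall eps : R, 0 < eps ->
    exists2 g, F g & (A_norm alpha (fun t => f t - g t)%R < eps%:E)%E].

Definition I_ideal alpha E : set (torus R n -> R[i]) :=
  [set f | A_alg alpha f /\ forall x, E x -> f x = 0].

Definition J_ideal alpha E : set (torus R n -> R[i]) :=
  A_closure alpha [set f | A_alg alpha f /\
    exists U, [/\ open U, E `<=` U & forall x, U x -> f x = 0]].

End WeightedFourierAlgebra.

(* Main.v *)
(** Fix an integer [p >= alpha + 2] and let [phi_q] be the tensor product of
    B-splines of order [p] supported in the cube [[0, 2 pi p / q]^n]; its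
    Fourier coefficients [kcoef] are products of powers of
    [(1 - e^{-ih}) / (ih)].  Let [F] be [f] cut off to the points at distance at
    least [2 delta] from [E], with [delta = (n + 1) 2 pi p / q].  The convolution
    of [F] with [phi_q] vanishes near [E], and its distance to [f] in [A_alpha]
    is at most [|| f - f * phi_q ||], which tends to 0, plus
    [|| (f - F) * phi_q ||].  By Cauchy-Schwarz the latter is bounded by
    [(sum_k |kcoef k|^2 (1 + |k|)^{2 alpha})^{1/2} = O(q^{alpha + n/2})] times the
    L^2 norm of [f] near [E].  That norm is [O(delta^{m + (n - c')/2})] by the
    covering property for some [c'] slightly above [c].  In the endpoint case
    [m = n/2 + alpha] it is [o(delta^m)] along some scales: [|f| <= A d^m] is tiny
    very close to [E], and the bands [u delta <= d < 2 delta] are disjoint for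
    widely spaced [delta], so one of them carries little mass.

    No integral is needed: convolutions and norms are taken over the grid
    [(2 pi / M) Z^n] with [M] large, the Fourier coefficients on the grid
    being those of [f] up to aliasing. *)
Require Import Defs.
From mathcomp Require Import all_boot all_order all_algebra finmap generic_quotient.
From mathcomp Require Import all_classical all_reals all_analysis.
From mathcomp Require Import complex.
From mathcomp Require Import showcase.summability.
From mathcomp Require Import zify ring lra.
Import Order.TTheory GRing.Theory Num.Theory.
Import numFieldNormedType.Exports.
Local Open Scope classical_set_scope.
Local Open Scope ring_scope.

Set Implicit Arguments.
Unset Strict Implicit.
Unset Printing Implicit Defensive.

Local Notation nc := Normc.normc.

(** * The modulus on the complex numbers *)

Section ComplexModulus.
Context (R : realType).
Implicit Types x y z : R[i].

Lemma nc_ge0 x : 0 <= nc x. Proof. by case: x => a b; exact: sqrtr_ge0. Qed.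

Lemma nc0 : nc (0 : R[i]) = 0. Proof. exact: Normc.normc0. Qed.

Lemma nc1 : nc (1 : R[i]) = 1. Proof. exact: Normc.normc1. Qed.

Lemma ncM x y : nc (x * y) = nc x * nc y. Proof. exact: Normc.normcM. Qed.

Lemma ncN x : nc (- x) = nc x. Proof. exact: normcN. Qed.

Lemma ncD x y : nc (x + y) <= nc x + nc y. Proof. exact: le_normcD. Qed.

Lemma ncB x y : nc (x - y) <= nc x + nc y.
Proof. by rewrite -(ncN y) ncD. Qed.

Lemma nc_distC x y : nc (x - y) = nc (y - x).
Proof. by rewrite -ncN opprB. Qed.

Lemma ncX x k : nc (x ^+ k) = nc x ^+ k.
Proof. by elim: k => [|k IH]; rewrite ?nc1// !exprS ncM IH. Qed.

Lemma nc_real (r : R) : nc (r%:C)%C = `|r|.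
Proof. by rewrite /= expr0n addr0 sqrtr_sqr. Qed.

Lemma nc_nat k : nc (k%:R : R[i]) = k%:R.
Proof. by rewrite -(rmorph_nat (real_complex R)) nc_real normr_nat. Qed.

Lemma ncV x : nc x^-1 = (nc x)^-1. Proof. exact: Normc.normcV. Qed.

Lemma nc_eq0 x : nc x = 0 -> x = 0. Proof. exact: Normc.eq0_normc. Qed.

Lemma nc_le_eq0 x : (forall e : R, 0 < e -> nc x <= e) -> x = 0.
Proof.
move=> H; apply: nc_eq0; apply/eqP; rewrite eq_le nc_ge0 andbT.
by apply/ler_addgt0Pr => e e0; rewrite add0r H.
Qed.

Lemma nc_sum (I : Type) (r : seq I) (P : pred I) (F : I -> R[i]) :
  nc (\sum_(i <- r | P i) F i) <= \sum_(i <- r | P i) nc (F i).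
Proof.
elim/big_ind2 : _ => [|x1 x2 y1 y2 H1 H2|//]; first by rewrite nc0.
by rewrite (le_trans (ncD _ _))// lerD.
Qed.

Lemma nc_prod (I : Type) (r : seq I) (P : pred I) (F : I -> R[i]) :
  nc (\prod_(i <- r | P i) F i) = \prod_(i <- r | P i) nc (F i).
Proof. by elim/big_rec2 : _ => [|i x y _ IH]; rewrite ?nc1// ncM IH. Qed.

Lemma nc_sqr x : (nc x ^+ 2)%:C%C = x * x^*%C.
Proof.
rewrite -sqr_normc normc_def rmorphXn; congr (_ ^+ 2).
by case: x.
Qed.

Lemma nc_Re_Im x : nc x <= `|complex.Re x| + `|complex.Im x|.
Proof.
case: x => a b; have -> : (a +i* b)%C = (a%:C + (0 +i* b))%C.
  by apply/eqP; rewrite eq_complex /= addr0 add0r !eqxx.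
apply: le_trans (ncD _ _) _.
by rewrite nc_real /= expr0n !add0r addr0 sqrtr_sqr.
Qed.

Lemma Re_le_nc x : `|complex.Re x| <= nc x.
Proof.
by case: x => a b /=; rewrite -sqrtr_sqr ler_wsqrtr// lerDl sqr_ge0.
Qed.

Lemma Im_le_nc x : `|complex.Im x| <= nc x.
Proof.
by case: x => a b /=; rewrite -sqrtr_sqr ler_wsqrtr// lerDr sqr_ge0.
Qed.

Lemma nc_sub_exp x y k : nc x <= 1 -> nc y <= 1 ->
  nc (x ^+ k - y ^+ k) <= k%:R * nc (x - y).
Proof.
move=> x1 y1; elim: k => [|k IH]; first by rewrite subrr nc0 mul0r.
have -> : x ^+ k.+1 - y ^+ k.+1 = x * (x ^+ k - y ^+ k) + (x - y) * y ^+ k.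
  by rewrite !exprS mulrBr mulrBl addrA subrK.
rewrite (le_trans (ncD _ _))// !ncM -natr1 mulrDl mul1r lerD//.
  by rewrite (le_trans _ IH)// ler_piMl// nc_ge0.
by rewrite ler_piMr ?nc_ge0// ncX exprn_ile1// nc_ge0.
Qed.

(** Replace one factor at a time: each exchange costs one difference, since the remaining factors
    have modulus at most 1. *)
Lemma nc_sub_prod (I : Type) (r : seq I) (F G : I -> R[i]) :
  (forall i, nc (F i) <= 1) -> (forall i, nc (G i) <= 1) ->
  nc (\prod_(i <- r) F i - \prod_(i <- r) G i) <= \sum_(i <- r) nc (F i - G i).
Proof.
move=> F1 G1; elim: r => [|i r IH]; first by rewrite !big_nil subrr nc0.
rewrite !big_cons.
set f := \prod_(j <- r) F j in IH *; set g := \prod_(j <- r) G j in IH *.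
have -> : F i * f - G i * g = (F i - G i) * f + G i * (f - g) by ring.
rewrite (le_trans (ncD _ _))// !ncM lerD//.
  rewrite ler_piMr ?nc_ge0// /f nc_prod prodr_ile1// => j _.
  by rewrite nc_ge0 F1.
by rewrite (le_trans _ IH)// ler_piMl ?nc_ge0.
Qed.

End ComplexModulus.

(** * The unit circle: chords, arcs and Taylor estimates *)

Section Cis.
Context (R : realType).
Implicit Types x y : R.

Definition cis x : R[i] := (cos x +i* sin x)%C.

Lemma cis0 : cis 0 = 1. Proof. by rewrite /cis cos0 sin0. Qed.

Lemma cisD x y : cis (x + y) = cis x * cis y.
Proof.
apply/eqP; rewrite /cis eq_complex /= cosD sinD eqxx /=.
by apply/eqP; ring.
Qed.

Lemma cis_sum (I : Type) (r : seq I) (P : pred I) (F : I -> R) :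
  cis (\sum_(i <- r | P i) F i) = \prod_(i <- r | P i) cis (F i).
Proof. by elim/big_rec2 : _ => [|i x y _ IH]; rewrite ?cis0// cisD IH. Qed.

Lemma nc_cis x : nc (cis x) = 1.
Proof. by rewrite /= cos2Dsin2 sqrtr1. Qed.

Lemma cisN x : cis (- x) = (cis x)^*%C.
Proof. by rewrite /cis cosN sinN. Qed.

Lemma cisX x k : cis x ^+ k = cis (k%:R * x).
Proof.
elim: k => [|k IH]; first by rewrite mul0r cis0.
by rewrite exprS IH -cisD -natr1 mulrDl mul1r addrC.
Qed.

Lemma cis2pi_nat k : cis (2 * pi * k%:R) = 1.
Proof.
rewrite mulrC -cisX.
have -> : cis (2 * pi) = 1 by rewrite /cis mulr_natl cos2pi sin2pi.
by rewrite expr1n.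
Qed.

Lemma cis2pi (k : int) : cis (2 * pi * k%:~R) = 1.
Proof.
case: k => k; first exact: cis2pi_nat.
by rewrite NegzE mulrNz mulrN cisN cis2pi_nat conjc1.
Qed.

Lemma nc_cis_sub1E x : nc (cis x - 1) = 2 * `|sin (x / 2)|.
Proof.
have -> : 2 * `|sin (x / 2)| = `|2 * sin (x / 2)|.
  by rewrite normrM (ger0_norm (ler0n R 2)).
rewrite -sqrtr_sqr /= subr0; congr Num.sqrt.
have c2 := cos2Dsin2 x.
have -> : (cos x - 1) ^+ 2 + sin x ^+ 2 = 2 - 2 * cos x by nra.
rewrite [x in cos x]splitr cosD; have := cos2Dsin2 (x / 2); nra.
Qed.

Lemma sin_MVT x : 0 < x -> exists c, [/\ 0 < c, c < x & sin x = cos c * x].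
Proof.
move=> x0; have dsin z : is_derive z (1 : R) sin (cos z) by exact: is_derive_sin.
have csin : {within `[0, x], continuous (@sin R)}.
  by apply: continuous_subspaceT => z; exact: continuous_sin.
have [c] := MVT x0 (fun z _ => dsin z) csin.
by rewrite in_itv/= sin0 !subr0 => /andP[c0 cx] ->; exists c.
Qed.

Lemma norm_sin_le x : `|sin x| <= `|x|.
Proof.
wlog x0 : x / 0 <= x.
  move=> H; have [/H//|/ltW x0] := leP 0 x.
  by rewrite -normrN -sinN -[leRHS]normrN H// oppr_ge0.
move: x0; rewrite le_eqVlt => /predU1P[<-|x0]; first by rewrite sin0.
have [c [_ _ ->]] := sin_MVT x0; by rewrite normrM ler_piMl// cos_max.
Qed.

Lemma nc_cis_sub1 x : nc (cis x - 1) <= `|x|.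
Proof.
rewrite nc_cis_sub1E; have := norm_sin_le (x / 2).
by rewrite normrM normfV (ger0_norm (_ : 0 <= 2)) ?ler0n//; lra.
Qed.

Lemma nc_cis_sub x y : nc (cis x - cis y) <= `|x - y|.
Proof.
rewrite -[x in cis x](subrK y) cisD -[X in _ - X]mul1r -mulrBl ncM nc_cis mulr1.
exact: nc_cis_sub1.
Qed.

(** Real and imaginary parts are treated separately: [|cos x - 1| <= x^2 / 2] and
    [|sin x - x| <= x^2], with some slack in the constant. *)
Lemma nc_cis_taylor x : nc (cis x - 1 - 'i%C * x%:C%C) <= 2 * x ^+ 2.
Proof.
apply: le_trans (nc_Re_Im _) _.
have -> : complex.Re (cis x - 1 - 'i%C * x%:C%C) = cos x - 1 by rewrite /=; ring.
have -> : complex.Im (cis x - 1 - 'i%C * x%:C%C) = sin x - x by rewrite /=; ring.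
have c1 (z : R) : `|cos z - 1| <= z ^+ 2 / 2.
  have b2 : sin (z / 2) ^+ 2 <= (z / 2) ^+ 2.
    by rewrite -real_normK ?num_real// -[leRHS]real_normK ?num_real// lerXn2r ?nnegrE// norm_sin_le.
  rewrite [z in cos z]splitr cosD ler_norml; have h := cos2Dsin2 (z / 2).
  by apply/andP; split; nra.
suff : `|sin x - x| <= x ^+ 2 by move: (c1 x); nra.
wlog x0 : x / 0 <= x.
  move=> H; have [/H//|/ltW x0] := leP 0 x.
  have := H (- x); rewrite sinN -opprD normrN sqrrN; apply.
  by rewrite oppr_ge0.
move: x0; rewrite le_eqVlt => /predU1P[<-|x0].
  by rewrite sin0 subrr normr0 expr0n.
(* By the mean value theorem [sin x - x = (cos c - 1) x], and [|cos c - 1| <= c < x]. *)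
have [c [c0 cx ->]] := sin_MVT x0.
rewrite -[X in _ - X]mul1r -mulrBl normrM (gtr0_norm x0) expr2 ler_wpM2r ?(ltW x0)//.
have : `|cos c - 1| <= c.
  have := nc_cis_sub1 c; rewrite (gtr0_norm c0); apply: le_trans.
  exact: (Re_le_nc (cis c - 1)).
lra.
Qed.

(* The chord-arc inequality, with 1/2 in place of the sharp 2/pi. *)
Lemma nc_cis_sub1_ge x : `|x| <= pi -> `|x| / 2 <= nc (cis x - 1).
Proof.
rewrite nc_cis_sub1E; wlog x0 : x / 0 <= x.
  move=> H; have [/H//|/ltW x0] := leP 0 x.
  have := H (- x); rewrite normrN mulNr sinN normrN; apply.
  by rewrite oppr_ge0.
rewrite ger0_norm//.
move: x0; rewrite le_eqVlt => /predU1P[<-|x0]; first by rewrite !mul0r sin0 normr0 mulr0.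
(* With [z = x / 4], doubling and the mean value theorem give [sin (x / 2) = 2 cos z cos c z] for
   some [0 < c < z]. Both cosines are at least [cos (pi / 4)], so their product is at least 1/2. *)
move=> xpi; set z := x / 4.
have z0 : 0 < z by rewrite divr_gt0.
have zpi : z <= pi / 4 by rewrite ler_wpM2r// invr_ge0.
have -> : x / 2 = z *+ 2 by rewrite mulr2n /z; field.
rewrite sin_mulr2n.
have cpi4 : cos (pi / 4 : R) ^+ 2 = 2^-1.
  have := cos_pihalf R; rewrite -[pi / 2](_ : (pi / 4 : R) *+ 2 = pi / 2).
    by rewrite cos_mulr2n mulr2n; lra.
  by rewrite mulr2n; field.
have pi0 := pi_gt0 R.
have cpi4_ge0 : 0 <= cos (pi / 4 : R).
  by apply: cos_ge0_pihalf; apply/andP; split; lra.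
have cosge y : 0 <= y -> y <= z -> cos (pi / 4) <= cos y.
  move=> y0 yz; rewrite leNgt ltr_cos ?in_itv/= -?leNgt; last 2 first.
  - by apply/andP; split; lra.
  - by apply/andP; split; lra.
  lra.
have [c [c0 cz ->]] := sin_MVT z0.
have h1 := cosge _ (ltW c0) (ltW cz); have h2 := cosge _ (ltW z0) (lexx z).
rewrite -(mulr_natl (_ * _)) ger0_norm; last by rewrite !mulr_ge0 ?(ltW z0)//; lra.
have h3 : 2^-1 <= cos z * cos c by rewrite -cpi4 expr2 ler_pM.
have : 2^-1 * z <= cos z * cos c * z by rewrite ler_wpM2r// ltW.
by rewrite -[z *+ 2]mulr_natl; lra.
Qed.

End Cis.

(** * Fourier coefficients of an arc and of its discretization *)

Section SplineCoefficients.
Context (R : realType).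
Implicit Types (k : int) (q N : nat).

Definition angle q k : R := 2 * pi * k%:~R / q%:R.

(* With h = 2 pi / q, the k-th Fourier coefficient of the uniform probability
   density on the arc [0, h]. *)
Definition arc_coef q k : R[i] :=
  if k == 0 then 1 else (1 - cis (- angle q k)) / ('i%C * (angle q k)%:C%C).

(* The same coefficient for N equidistributed point masses on that arc. *)
Definition darc_coef q N k : R[i] :=
  N%:R^-1 * \sum_(s < N) cis (- (angle q k * s%:R / N%:R)).

Lemma angle_neq0 q k : (0 < q)%N -> k != 0 -> angle q k != 0.
Proof.
move=> q0 k0; rewrite !mulf_neq0 ?invr_neq0 ?pnatr_eq0 -?lt0n ?intr_eq0//.
by rewrite gt_eqF// pi_gt0.
Qed.

Lemma nc_i_angle q k : nc ('i%C * (angle q k)%:C%C) = `|angle q k|.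
Proof. by rewrite ncM nc_real -[nc _]/(Num.sqrt _) expr0n expr1n add0r sqrtr1 mul1r. Qed.

Lemma i_angle_neq0 q k : (0 < q)%N -> k != 0 -> ('i%C * (angle q k)%:C%C) != 0.
Proof.
move=> q0 k0; apply/eqP => /(congr1 (@nc R)); rewrite nc_i_angle nc0.
by apply/eqP; rewrite normr_eq0 angle_neq0.
Qed.

Lemma norm_angle q k : `|angle q k| = 2 * pi * `|k|%:~R / q%:R.
Proof.
by rewrite !normrM normfV !normr_nat (ger0_norm (pi_ge0 R)) intr_norm.
Qed.

Lemma nc_arc_coef q k : nc (arc_coef q k) <= 1.
Proof.
rewrite /arc_coef; case: eqP => [_|_]; first by rewrite nc1.
rewrite ncM ncV nc_i_angle nc_distC.
have [->|a0] := eqVneq (angle q k) 0; first by rewrite normr0 invr0 mulr0.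
by rewrite ler_pdivrMr ?normr_gt0// mul1r -(normrN (angle q k)) nc_cis_sub1.
Qed.

(** The numerator has modulus at most 2 and the denominator is [2 pi |k| / q]: decay sets in at
    frequency [q]. *)
Lemma nc_arc_coef_decay q k : (0 < q)%N ->
  nc (arc_coef q k) * `|k|%:~R <= q%:R.
Proof.
move=> q0; have [->|k0] := eqVneq k 0; first by rewrite normr0 mulr0 ler0n.
rewrite /arc_coef (negbTE k0) ncM ncV nc_i_angle norm_angle.
have h : nc (1 - cis (- angle q k)) <= 2.
  by rewrite (le_trans (ncB _ _))// nc1 nc_cis.
have k1 : (0 : R) < `|k|%:~R by rewrite ltr0z normr_gt0.
have qR : (0 : R) < q%:R by rewrite ltr0n.
have p2 := pi_ge2 R.
have -> : nc (1 - cis (- angle q k)) / (2 * pi * `|k|%:~R / q%:R) * `|k|%:~R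
   = nc (1 - cis (- angle q k)) / (2 * pi) * q%:R.
  have := pi_gt0 R; move: (pi : R) (nc _) => P B P0; field.
  by rewrite !gt_eqF.
rewrite ler_piMl ?(ltW qR)// ler_pdivrMr ?mulr_gt0 ?pi_gt0//; lra.
Qed.

(** The Taylor estimate divided by [|angle q k|]. For fixed [k] it makes the coefficients tend to 1
    as [q] grows. *)
Lemma nc_arc_coef_sub1 q k : (0 < q)%N ->
  nc (arc_coef q k - 1) <= 2 * `|angle q k|.
Proof.
move=> q0; have [->|k0] := eqVneq k 0.
  by rewrite /arc_coef eqxx subrr nc0 mulr_ge0.
have i0 := i_angle_neq0 q0 k0; have a0 := angle_neq0 q0 k0.
rewrite /arc_coef (negbTE k0) -{2}(divff i0) -mulrBl ncM ncV nc_i_angle.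
rewrite ler_pdivrMr ?normr_gt0// -mulrA -expr2 real_normK ?num_real//.
rewrite -(sqrrN (angle q k)); apply: le_trans (nc_cis_taylor _).
rewrite -ncN le_eqVlt; apply/orP; left; apply/eqP; congr nc.
have -> : (- angle q k)%:C%C = - (angle q k)%:C%C :> R[i] by rewrite rmorphN.
by move: ('i%C : R[i]) (cis _) (_%:C)%C => I C X; ring.
Qed.

Lemma nc_darc_coef q N k : nc (darc_coef q N k) <= 1.
Proof.
rewrite /darc_coef ncM ncV nc_nat.
have [->|N0] := posnP N; first by rewrite invr0 mul0r.
rewrite mulrC ler_pdivrMr ?ltr0n// mul1r (le_trans (nc_sum _ _ _))//.
by under eq_bigr do rewrite nc_cis; rewrite sumr_const card_ord.
Qed.

(** A geometric sum, kept in multiplied form so that a ratio equal to 1 is covered. The right-hand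
    side is the numerator of [arc_coef], which links the two families. *)
Lemma darc_coef_geo q N k : (0 < N)%N ->
  darc_coef q N k * N%:R * (1 - cis (- (angle q k / N%:R))) =
  1 - cis (- angle q k).
Proof.
move=> N0; have N0' : (N%:R : R[i]) != 0 by rewrite pnatr_eq0 -lt0n.
have N0R : (N%:R : R) != 0 by rewrite pnatr_eq0 -lt0n.
have -> : darc_coef q N k * N%:R = \sum_(s < N) cis (- (angle q k / N%:R)) ^+ s.
  rewrite /darc_coef mulrAC mulVf// mul1r; apply: eq_bigr => s _.
  by rewrite cisX; congr cis; field.
rewrite -opprB mulrN mulrC -subrX1 opprB cisX; congr (_ - cis _).
by field.
Qed.

(** [darc_coef] has period [q * N] in [k], so decay can hold only on half a period. There the
    chord-arc inequality bounds the factor [1 - cis (- (angle q k / N))] of the geometric sum from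
    below. *)
Lemma nc_darc_coef_decay q N k : (0 < q)%N -> (0 < N)%N ->
  `|k|%:~R * 2 <= (q * N)%:R :> R -> nc (darc_coef q N k) * `|k|%:~R <= q%:R.
Proof.
move=> q0 N0 kqN.
have qR : (0 : R) < q%:R by rewrite ltr0n.
have NR : (0 : R) < N%:R by rewrite ltr0n.
have p0 := pi_gt0 R; have p2 := pi_ge2 R.
have := congr1 (@nc R) (darc_coef_geo q k N0).
move: (darc_coef q N k) => dc.
rewrite !ncM nc_nat nc_distC => e.
have h : nc (1 - cis (- angle q k)) <= 2.
  by rewrite (le_trans (ncB _ _))// nc1 nc_cis.
have aN : `|- (angle q k / N%:R)| = 2 * pi * `|k|%:~R / (q%:R * N%:R).
  by rewrite normrN normrM norm_angle normfV normr_nat; field; rewrite !gt_eqF.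
have := nc_cis_sub1_ge (x := - (angle q k / N%:R)); rewrite aN.
have -> : 2 * pi * `|k|%:~R / (q%:R * N%:R) <= pi :> R.
  by rewrite ler_pdivrMr ?mulr_gt0//; rewrite natrM in kqN; nra.
move=> /(_ isT) c; set D := nc dc in e *.
have D0 : 0 <= D by exact: nc_ge0.
have : D * N%:R * (2 * pi * `|k|%:~R / (q%:R * N%:R) / 2) <= 2.
  by rewrite (le_trans _ h)// -e ler_wpM2l// mulr_ge0// ltW.
have -> : D * N%:R * (2 * pi * `|k|%:~R / (q%:R * N%:R) / 2) =
   (D * `|k|%:~R) * pi / q%:R by field; rewrite !gt_eqF.
rewrite ler_pdivrMr// => H.
have : 0 <= D * `|k|%:~R by rewrite mulr_ge0// ler0z.
nra.
Qed.

(** Multiplied by [i * angle q k], the difference becomes [darc_coef] times [i * angle q k - N (1 -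
    cis (- (angle q k / N)))], which is [N] times a second-order Taylor remainder at
    [angle q k / N]. *)
Lemma nc_darc_arc_coef q N k : (0 < q)%N -> (0 < N)%N ->
  nc (darc_coef q N k - arc_coef q k) <= 2 * `|angle q k| / N%:R.
Proof.
move=> q0 N0; have NR : (0 : R) < N%:R by rewrite ltr0n.
have [->|k0] := eqVneq k 0.
  have a0 : angle q 0 = 0 by rewrite /angle mulr0z mulr0 mul0r.
  rewrite a0 normr0 mulr0 mul0r /arc_coef eqxx /darc_coef.
  under eq_bigr do rewrite a0 !mul0r oppr0 cis0.
  rewrite sumr_const card_ord -[1 *+ N]/(N%:R) mulVf ?subrr ?nc0//.
  by rewrite pnatr_eq0 -lt0n.
have i0 := i_angle_neq0 q0 k0; have a0 := angle_neq0 q0 k0.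
have an0 : 0 < `|angle q k| by rewrite normr_gt0.
rewrite -(ler_pM2r an0) -{1}nc_i_angle -ncM mulrBl.
have -> : arc_coef q k * ('i%C * (angle q k)%:C%C) =
    darc_coef q N k * N%:R * (1 - cis (- (angle q k / N%:R))).
  by rewrite darc_coef_geo// /arc_coef (negbTE k0) divfK.
rewrite -[darc_coef q N k * _ * _]mulrA -mulrBr ncM.
apply: (@le_trans _ _ (1 * (2 * `|angle q k| ^+ 2 / N%:R))); last first.
  by rewrite mul1r; lra.
apply: ler_pM; rewrite ?nc_ge0 ?nc_darc_coef//.
have -> : ('i%C * (angle q k)%:C%C) - N%:R * (1 - cis (- (angle q k / N%:R))) =
  N%:R * (cis (- (angle q k / N%:R)) - 1 - ('i%C * (- (angle q k / N%:R))%:C%C)).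
  have -> : (- (angle q k / N%:R))%:C%C = - ((angle q k)%:C%C / N%:R) :> R[i].
    by rewrite rmorphN rmorphM fmorphV rmorph_nat.
  have N0' : (N%:R : R[i]) != 0 by rewrite pnatr_eq0 -lt0n.
  move: ('i%C : R[i]) (cis _) ((angle q k)%:C)%C (N%:R : R[i]) N0' => I C X N' N0'; by field.
rewrite ncM nc_nat (le_trans (ler_wpM2l (ler0n _ _) (nc_cis_taylor _)))//.
rewrite sqrrN real_normK ?num_real// le_eqVlt; apply/orP; left; apply/eqP.
by field; rewrite gt_eqF.
Qed.

(** The chord-arc inequality applies to [y] or to [y - 2 pi], whichever has absolute value at most
    [pi]. *)
Lemma cis_neq1 (y : R) : 0 < y < 2 * pi -> cis y != 1.
Proof.
move=> /andP[y0 y2]; apply/eqP => y1.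
have [yp|yp] := leP y pi.
  have := nc_cis_sub1_ge (x := y); rewrite y1 subrr nc0 gtr0_norm// => /(_ yp).
  lra.
have := nc_cis_sub1_ge (x := y - 2 * pi).
have -> : cis (y - 2 * pi) = 1.
  by rewrite cisD y1 mul1r; have := cis2pi R (-1); rewrite mulrN1.
rewrite subrr nc0 ltr0_norm; last by lra.
lra.
Qed.

Lemma cis_root_neq1 (M : nat) (d : int) : (0 < M)%N -> ~~ (M %| `|d|)%N ->
  cis (2 * pi * d%:~R / M%:R : R) != 1.
Proof.
move=> M0 Md; have MR : (0 : R) < M%:R by rewrite ltr0n.
have MZ : (M%:Z != 0) by rewrite eqz_nat -lt0n.
have -> : cis (2 * pi * d%:~R / M%:R) = cis (2 * pi * (d %% M)%Z%:~R / M%:R : R).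
  rewrite [in LHS](divz_eq d M) rmorphD rmorphM /= mulrDr mulrDl cisD.
  rewrite -[in RHS](mul1r (cis _)); congr (_ * _).
  rewrite -[RHS](cis2pi R (d %/ M)%Z); congr cis; field.
  by rewrite gt_eqF.
have dpos : (0 : R) < (d %% M)%Z%:~R.
  rewrite ltr0z lt_def modz_ge0// andbT.
  by apply: contra Md => /eqP/dvdz_mod0P; rewrite dvdzE.
have dM : (d %% M)%Z%:~R < (M%:R : R).
  by rewrite -[M%:R]/((M%:Z)%:~R) ltr_int ltz_pmod// ltz_nat.
apply: cis_neq1; have p0 := pi_gt0 R; apply/andP; split.
  by rewrite divr_gt0// !mulr_gt0.
by rewrite ltr_pdivrMr// ltr_pM2l// mulr_gt0.
Qed.

Lemma sum_cis_root (M : nat) (d : int) : (0 < M)%N -> ~~ (M %| `|d|)%N ->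
  \sum_(i < M) cis (2 * pi * d%:~R / M%:R * i%:R : R) = 0.
Proof.
move=> M0 Md; have MR : (0 : R) < M%:R by rewrite ltr0n.
under eq_bigr do rewrite mulrC -cisX.
set w := cis _; have w1 : w - 1 != 0 by rewrite subr_eq0 cis_root_neq1.
apply: (mulfI w1); rewrite mulr0 -subrX1 cisX -[X in _ - X](cis2pi R d).
apply/eqP; rewrite subr_eq0; apply/eqP; congr cis.
by field; rewrite gt_eqF.
Qed.

End SplineCoefficients.

(** * Vanishing of the one-dimensional spline off its support *)

Section SplineSupport.
Context (R : realType).
Implicit Types (k : int) (q N p K : nat).

Lemma inv_sqr_telescope (a : R) : 1 < a -> (a ^+ 2)^-1 <= (a - 1)^-1 - a^-1.
Proof.
move=> a1; have a0 : 0 < a by lra.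
have -> : (a - 1)^-1 - a^-1 = (a * (a - 1))^-1.
  by field; apply/andP; split; rewrite gt_eqF//; lra.
rewrite lef_pV2 ?posrE ?mulr_gt0 ?exprn_gt0//; last by lra.
by rewrite expr2 ler_wpM2l ?(ltW a0)//; lra.
Qed.

(* When the sum over a full period vanishes, a central block is as small as
   the tails, which quadratic decay controls. *)
Lemma central_block_bound (F : int -> R[i]) (C : R) (M K : nat) :
  (0 < K)%N -> (2 * K.+1 <= M)%N ->
  (forall k : int, `|k|%:~R * 2 <= M%:R :> R -> nc (F k) * `|k|%:~R ^+ 2 <= C) ->
  \sum_(i < M) F (i%:Z - (M./2)%:Z) = 0 ->
  nc (\sum_(i < (2 * K).+1) F (i%:Z - K%:Z)) <= 2 * C / K%:R.
Proof.
move=> K0 KM Fdecay; set H := M./2.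
have HM : (2 * H <= M)%N by rewrite /H; lia.
have MH : (M - H <= H.+1)%N by rewrite /H; lia.
have KH : (K.+1 <= H)%N by rewrite /H; lia.
have KR : (0 : R) < K%:R by rewrite ltr0n.
(* Quadratic decay in a form that telescopes over the tails. *)
have F2 (k : int) (a : nat) : `|k|%N = a -> (2 * a <= M)%N -> (1 < a)%N ->
    nc (F k) <= C * ((a%:R - 1)^-1 - a%:R^-1).
  move=> ka aM a1; have aR : (1 : R) < a%:R by rewrite ltr1n.
  have := Fdecay k; rewrite -abszE ka => /(_ _).
  have -> : (a%:Z)%:~R * 2 <= M%:R :> R.
    by rewrite -[(a%:Z)%:~R]/(a%:R : R) -natrM ler_nat mulnC.
  move=> /(_ isT); rewrite -[(a%:Z)%:~R]/(a%:R : R) => h.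
  have C0 : 0 <= C by rewrite (le_trans _ h)// mulr_ge0 ?nc_ge0 ?sqr_ge0.
  apply: le_trans (ler_wpM2l C0 (inv_sqr_telescope aR)).
  by rewrite ler_pdivlMr// exprn_gt0// (lt_trans _ aR).
have C0 : 0 <= C.
  have := Fdecay 0; rewrite normr0 mul0r ler0n expr0n mulr0; exact.
rewrite -(big_mkord xpredT (fun i => F (i%:Z - H%:Z))).
(* The period splits into a left tail [L], the block [Cn] of frequencies at most [K] in absolute
   value, and a right tail [Rt]. As the total is 0, [Cn = - (L + Rt)], and each tail telescopes to
   at most [C / K]. *)
rewrite (big_cat_nat _ (n := (H - K)%N))//=; last lia.
rewrite (big_cat_nat _ (m := (H - K)%N) (n := (H + K.+1)%N))//=; [|lia|lia].
set L := (X in X + _); set Cn := (X in _ + (X + _)); set Rt := (X in _ + (_ + X)).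
move=> /eqP; rewrite addrCA addr_eq0 => /eqP LCR.
have CnE : Cn = \sum_(i < (2 * K).+1) F (i%:Z - K%:Z).
  rewrite /Cn -{1}(add0n (H - K)%N) big_addn big_mkord.
  have -> : (H + K.+1 - (H - K))%N = (2 * K).+1 by lia.
  by apply: eq_bigr => i _; congr F; lia.
rewrite -CnE LCR ncN.
have Lle : nc L <= C / K%:R.
  rewrite (le_trans (nc_sum _ _ _))//.
  have -> : C / K%:R = \sum_(0 <= i < H - K) C * ((H%:R - i.+1%:R)^-1 - (H%:R - i%:R)^-1)
      + C / H%:R.
    rewrite -mulr_sumr (telescope_sumr (fun i => (H%:R - i%:R)^-1))//.
    rewrite -mulrDr subr0 subrK natrB; last lia.
    by rewrite opprB addrC subrK.
  rewrite -[leLHS]addr0 lerD//; last by rewrite divr_ge0.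
  rewrite big_nat_cond [leRHS]big_nat_cond; apply: ler_sum => i /andP[/andP[_ iH] _].
  have -> : (H%:R - i.+1%:R)^-1 - (H%:R - i%:R)^-1 =
      ((H - i)%:R - 1)^-1 - (H - i)%:R^-1 :> R.
    by rewrite natrB -?natr1 ?opprD ?addrA//; lia.
  by apply: F2; lia.
have Rle : nc Rt <= C / K%:R.
  rewrite (le_trans (nc_sum _ _ _))//.
  have -> : C / K%:R = \sum_(H + K.+1 <= i < M)
      C * (- (i.+1%:R - H%:R - 1)^-1 - (- (i%:R - H%:R - 1)^-1)) + C / (M%:R - H%:R - 1).
    rewrite -mulr_sumr (telescope_sumr (fun i => - (i%:R - H%:R - 1)^-1)); last lia.
    rewrite -mulrDr; congr (_ * _).
    rewrite natrD -natr1; have -> : H%:R + (K%:R + 1) - H%:R - 1 = K%:R :> R by ring.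
    ring.
  rewrite -[leLHS]addr0 lerD//; last first.
    by rewrite divr_ge0// -natrB ?subr_ge0 ?ler1n; lia.
  rewrite big_nat_cond [leRHS]big_nat_cond; apply: ler_sum => i /andP[/andP[Hi iM] _].
  have -> : - (i.+1%:R - H%:R - 1)^-1 - (- (i%:R - H%:R - 1)^-1) =
      ((i - H)%:R - 1)^-1 - (i - H)%:R^-1 :> R.
    rewrite natrB; last lia.
    rewrite -natr1; have -> : i%:R + 1 - H%:R - 1 = i%:R - H%:R :> R by ring.
    by rewrite opprK addrC.
  by apply: F2; lia.
rewrite (le_trans (ncD _ _))//; lra.
Qed.

(** Expanding the power over [p]-tuples exhibits the coefficients of a [p]-fold convolution: the
    masses sit at the sums of [p] elements of [{0, .., N - 1}]. *)
Lemma darc_coef_exp q N p k :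
  darc_coef R q N k ^+ p = N%:R^-1 ^+ p *
    \sum_(s : {ffun 'I_p -> 'I_N})
      cis (- (angle R q k * (\sum_j s j)%:R / N%:R)).
Proof.
rewrite /darc_coef exprMn; congr (_ * _).
rewrite -[p in LHS]card_ord -prodr_const bigA_distr_bigA /=.
apply: eq_bigr => s _; rewrite -cis_sum; congr cis.
by rewrite sumrN -mulr_suml -mulr_sumr natr_sum.
Qed.

(* Finite Fourier inversion: the left-hand side is, up to a factor, the p-fold
   convolution of the uniform mass on {0, .., N - 1} evaluated at x. *)
Lemma sum_darc_coef q N p (x H : nat) : (0 < q)%N -> (0 < N)%N ->
  (p * N.-1 < x)%N -> (x < q * N)%N ->
  \sum_(i < q * N) darc_coef R q N (i%:Z - H%:Z) ^+ p *
    cis ((i%:Z - H%:Z)%:~R * (2 * pi * x%:R / (q * N)%:R)) = 0.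
Proof.
move=> q0 N0 px xqN.
have qR : (q%:R : R) != 0 by rewrite pnatr_eq0 -lt0n.
have NR : (N%:R : R) != 0 by rewrite pnatr_eq0 -lt0n.
under eq_bigr do rewrite darc_coef_exp -[_ * _ * cis _]mulrA mulr_suml.
rewrite -mulr_sumr exchange_big /= big1 ?mulr0// => s _.
set S := (\sum_j s j)%N.
have Sp : (S <= p * N.-1)%N.
  rewrite -[p in leqRHS]card_ord -sum_nat_const leq_sum// => j _.
  by rewrite -ltnS prednK.
(* Since [S <= p (N - 1) < x < q N], the frequency [d] lies strictly between 0 and [q N], so the sum
   over the roots of unity vanishes. *)
set d : int := x%:Z - S%:Z.
have qN0 : (0 < q * N)%N by rewrite muln_gt0 q0.
transitivity (cis (- (H%:R * (2 * pi * d%:~R / (q * N)%:R))) *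
    \sum_(i < q * N) cis (2 * pi * d%:~R / (q * N)%:R * i%:R : R)).
  rewrite mulr_sumr; apply: eq_bigr => i _; rewrite -!cisD; congr cis.
  rewrite /angle /d natrM !rmorphB /= -!pmulrn; move: (pi : R) => P.
  by field; rewrite qR NR.
rewrite sum_cis_root ?mulr0// /d; apply/negP => /dvdn_leq; lia.
Qed.

(** The point [t] lies beyond the support [[0, 2 pi p / q]]. The sum is compared with its discrete
    analogue at a grid point [u] near [t], which [central_block_bound] controls; for fixed [K] the
    comparison error tends to 0 as [N] grows. *)
Lemma arc_coef_vanish q p K (t : R) : (0 < q)%N -> (1 < p)%N -> (0 < K)%N ->
  2 * pi * p%:R / q%:R <= t -> t < 2 * pi ->
  nc (\sum_(i < (2 * K).+1) arc_coef R q (i%:Z - K%:Z) ^+ p *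
        cis ((i%:Z - K%:Z)%:~R * t)) <= 2 * q%:R ^+ 2 / K%:R.
Proof.
move=> q0 p1 K0 pt t2.
have pi0 := pi_gt0 R.
have qR : (0 : R) < q%:R by rewrite ltr0n.
have t0 : 0 <= t by rewrite (le_trans _ pt)// !mulr_ge0 ?invr_ge0 ?pi_ge0.
apply/ler_addgt0Pr => e e0.
(* [B / N] bounds the cost of replacing [arc_coef] by [darc_coef] and [t] by [u]. *)
pose B := \sum_(i < (2 * K).+1) (p%:R * (2 * `|angle R q (i%:Z - K%:Z)|)
   + `|i%:Z - K%:Z|%:~R * (2 * pi / q%:R)).
have B0 : 0 <= B.
  apply: sumr_ge0 => i _; rewrite addr_ge0 ?mulr_ge0 ?invr_ge0 ?pi_ge0 ?ler0z//.
(* The first summand gives [B / N <= e]; the second makes the period long enough for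
   [central_block_bound]. *)
pose N := (Num.truncn (B / e) + 2 * K.+1)%N.
have N0 : (0 < N)%N by rewrite /N; lia.
have NR : (0 : R) < N%:R by rewrite ltr0n.
have BN : B / N%:R <= e.
  rewrite ler_pdivrMr// mulrC -ler_pdivrMr//.
  rewrite (le_trans (ltW (truncnS_gt _)))// ler_nat /N -addn1 leq_add2l; lia.
pose M := (q * N)%N.
have MR : (0 : R) < M%:R by rewrite ltr0n /M muln_gt0 q0.
pose y := t * M%:R / (2 * pi).
have y0 : 0 <= y by rewrite divr_ge0 ?mulr_ge0 ?pi_ge0// ltW.
(* [u = 2 pi x / M] is the last grid point not exceeding [t]; it still lies beyond the discrete
   support, because [t >= 2 pi p / q] gives [p N <= x]. *)
pose x := Num.truncn y.
have xy : x%:R <= y by rewrite /x; have := truncn_itv y0 => /andP[].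
have yx : y < x%:R + 1 by rewrite natr1 truncnS_gt.
have px : (p * N <= x)%N.
  rewrite truncn_ge_nat// natrM /y /M natrM ler_pdivlMr ?mulr_gt0//.
  rewrite (_ : p%:R * N%:R * (2 * pi) = 2 * pi * p%:R / q%:R * (q%:R * N%:R)).
    by rewrite ler_wpM2r// mulr_ge0// ltW.
  by move: (pi : R) => P; field; rewrite gt_eqF.
have xM : (x < M)%N.
  rewrite -(ltr_nat R) (le_lt_trans xy)// /y ltr_pdivrMr ?mulr_gt0//.
  by rewrite mulrC ltr_pM2l.
pose u : R := 2 * pi * x%:R / M%:R.
have tu : `|u - t| <= 2 * pi / q%:R / N%:R.
  have -> : u - t = - ((y - x%:R) * (2 * pi / M%:R)).
    rewrite /u /y; move: (pi : R) pi0 => P P0; field; rewrite !gt_eqF//.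
  have -> : 2 * pi / q%:R / N%:R = 2 * pi / M%:R :> R.
    rewrite /M natrM; move: (pi : R) => P; field; rewrite !gt_eqF//.
  rewrite normrN ger0_norm; last by rewrite mulr_ge0 ?subr_ge0// divr_ge0 ?mulr_ge0 ?ltW.
  by rewrite ler_piMl ?divr_ge0 ?mulr_ge0 ?ltW//; lra.
pose F k := darc_coef R q N k ^+ p * cis (k%:~R * u).
have Fb : nc (\sum_(i < (2 * K).+1) F (i%:Z - K%:Z)) <= 2 * q%:R ^+ 2 / K%:R.
  apply: (@central_block_bound F (q%:R ^+ 2) M K K0).
  - by apply: (@leq_trans N); rewrite ?leq_pmull// leq_addl.
  - move=> k kM; rewrite /F ncM nc_cis mulr1 ncX.
    have D1 := nc_darc_coef R q N k.
    have D2 := nc_darc_coef_decay q0 N0 kM.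
    (* Two of the [p] factors supply the quadratic decay; the other [p - 2] are bounded by 1. *)
    apply: (@le_trans _ _ ((nc (darc_coef R q N k) * `|k|%:~R) ^+ 2)).
      rewrite exprMn ler_wpM2r ?sqr_ge0// -(subnK p1) exprD.
      by rewrite ler_piMl ?sqr_ge0// exprn_ile1 ?nc_ge0.
    by rewrite lerXn2r ?nnegrE ?mulr_ge0 ?nc_ge0 ?ler0z.
  - rewrite /F; apply: sum_darc_coef => //.
    by rewrite (leq_trans _ px)// (ltn_pmul2l (ltnW p1)) ltn_predL.
rewrite -[X in nc X](subrK (\sum_(i < (2 * K).+1) F (i%:Z - K%:Z))).
rewrite (le_trans (ncD _ _))// addrC lerD// (le_trans _ BN)//.
rewrite -sumrB (le_trans (nc_sum _ _ _))// /B mulr_suml ler_sum// => i _.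
set k := (i%:Z - K%:Z); rewrite /F.
set a := arc_coef R q k ^+ p; set b := darc_coef R q N k ^+ p.
have -> : a * cis (k%:~R * t) - b * cis (k%:~R * u) =
   (a - b) * cis (k%:~R * t) + b * (cis (k%:~R * t) - cis (k%:~R * u)) by ring.
rewrite (le_trans (ncD _ _))// !ncM nc_cis mulr1 mulrDl lerD//.
  rewrite nc_distC (le_trans (nc_sub_exp _ _ _)) ?nc_arc_coef ?nc_darc_coef//.
  by rewrite -mulrA ler_wpM2l// nc_darc_arc_coef.
rewrite (@le_trans _ _ (1 * `|k%:~R * t - k%:~R * u|))//.
  rewrite ler_pM ?nc_ge0 ?nc_cis_sub// /b ncX exprn_ile1 ?nc_ge0 ?nc_darc_coef//.
rewrite mul1r -mulrBr normrM -intr_norm -[leRHS]mulrA ler_wpM2l ?ler0z//.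
by rewrite distrC.
Qed.

End SplineSupport.

#[local] Existing Instance totally_filter.

(** * Unconditional summation over finite sets *)

Section FiniteSums.
Context (R : realType) (K : choiceType).
Implicit Types (u : K -> R) (S T : {fset K}).

Lemma ler_sum_fsubset u S T : (forall k, 0 <= u k) -> (S `<=` T)%fset ->
  \sum_(k <- S) u k <= \sum_(k <- T) u k.
Proof.
move=> u0 ST; rewrite (big_fsetID _ (mem S) T)/=.
have -> : [fset x in T | x \in mem S]%fset = S.
  apply/fsetP => x; rewrite !inE /=; apply/andP/idP => [[]//|xS].
  by rewrite (fsubsetP ST).
by rewrite lerDl sumr_ge0.
Qed.

(** Choose [S] whose sum is within [e] of the supremum of all finite sums; whatever lies outside [S]
    can add at most [e]. *)
Lemma bounded_sums_tail u (B : R) : (forall k, 0 <= u k) ->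
  (forall S, \sum_(k <- S) u k <= B) ->
  forall e, 0 < e -> exists S, forall T, \sum_(k <- T | k \notin S) u k <= e.
Proof.
move=> u0 uB e e0; pose X := [set \sum_(k <- S) u k | S in [set: {fset K}]].
have hX : has_sup X.
  split; first by exists (\sum_(k <- fset0) u k), fset0.
  by exists B => _ [S _ <-].
have [_ [S _ <-] SX] := sup_adherent e0 hX; exists S => T.
have : \sum_(k <- (S `|` T)%fset) u k <= sup X.
  by apply: sup_upper_bound => //; exists (S `|` T)%fset.
rewrite (big_fsetID _ (mem S))/=.
have -> : [fset x in (S `|` T)%fset | x \in mem S]%fset = S.
  by apply/fsetP => x; rewrite !inE /=; case: (x \in S); rewrite ?andbF.
rewrite -big_fset_condE /=.
have : \sum_(k <- T | k \notin S) u k <= \sum_(k <- (S `|` T)%fset | k \notin S) u k.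
  rewrite [leLHS]big_fset_condE [leRHS]big_fset_condE; apply: ler_sum_fsubset => //.
  by apply/fsubsetP => x; rewrite !inE /= => /andP[-> ->]; rewrite orbT.
set c := \sum_(k <- T | _) _; set b := \sum_(k <- (_ `|` _)%fset | _) _.
move: SX; move: (\sum_(k <- S) u k) (sup X) c b => a s c b; lra.
Qed.

(** Subtracting the sum over [S0] bounds every finite sum outside [S0] by 2. Taking only terms whose
    real part has a given sign bounds the absolute real parts by 2 + 2; the imaginary parts are
    alike, whence the constant 8. *)
Lemma nc_unconditional_bounded (z : K -> R[i]) :
  (exists S0, forall T, (S0 `<=` T)%fset -> nc (\sum_(k <- T) z k) <= 1) ->
  exists B, forall S, \sum_(k <- S) nc (z k) <= B.
Proof.
move=> [S0 H].
have disj T : nc (\sum_(k <- T | k \notin S0) z k) <= 2.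
  have := H (S0 `|` T)%fset (fsubsetUl _ _); rewrite (big_fsetID _ (mem S0))/=.
  have -> : [fset x in (S0 `|` T)%fset | x \in mem S0]%fset = S0.
    by apply/fsetP => x; rewrite !inE /=; case: (x \in S0); rewrite ?andbF.
  have -> : [fset x in (S0 `|` T)%fset | x \notin mem S0]%fset =
      [fset x in T | x \notin S0]%fset.
    by apply/fsetP => x; rewrite !inE /=; case: (x \in S0); rewrite ?andbF ?andbT.
  rewrite -big_fset_condE /= => H1.
  have := H _ (fsubset_refl S0).
  set a := \sum_(k <- S0) _ in H1 *; set b := \sum_(k <- T | _) _ in H1 * => H2.
  have -> : b = (a + b) - a by rewrite addrAC subrr add0r.
  by rewrite (le_trans (ncB _ _))//; lra.
have half (g : R[i] -> R) : (forall x, `|g x| <= nc x) -> {morph g : x y / x + y} ->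
    g 0 = 0 -> forall T, \sum_(k <- T | k \notin S0) `|g (z k)| <= 4.
  move=> gle gD g0 T.
  rewrite (bigID (fun k => 0 <= g (z k)))/=.
  have side (P : pred K) : `|\sum_(k <- T | (k \notin S0) && P k) g (z k)| <= 2.
    rewrite -(big_morph g gD g0) (le_trans (gle _))//.
    have := disj [fset k in T | P k]%fset.
    rewrite big_fset_condE; apply: le_trans; rewrite [X in nc X <= _]big_fset_condE.
    have -> // : [fset x in T | (x \notin S0) && P x]%fset =
      [fset x in [fset k in T | P k] | x \notin S0]%fset.
    by apply/fsetP => x; rewrite !inE /= -andbA [(_ \notin _) && _]andbC.
  have := side (fun k => 0 <= g (z k)).
  have := side (fun k => ~~ (0 <= g (z k))).
  rewrite (eq_bigr (fun k => - `|g (z k)|)); last first.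
    by move=> k /andP[_]; rewrite -ltNge => gk; rewrite ltr0_norm// opprK.
  rewrite [X in _ -> `|X| <= _ -> _](eq_bigr (fun k => `|g (z k)|)); last first.
    by move=> k /andP[_] gk; rewrite ger0_norm.
  rewrite sumrN normrN => /(le_trans (ler_norm _)) h1 /(le_trans (ler_norm _)) h2.
  lra.
exists (\sum_(k <- S0) nc (z k) + 8) => S.
apply: (@le_trans _ _ (\sum_(k <- S0) nc (z k) + \sum_(k <- S | k \notin S0) nc (z k))).
  rewrite (big_fsetID _ (mem S0) S)/= lerD//; last by rewrite -big_fset_condE.
    apply: ler_sum_fsubset; first by move=> k; exact: nc_ge0.
    by apply/fsubsetP => x; rewrite !inE /= => /andP[].
rewrite lerD2l.
have := half (@complex.Re R) (@Re_le_nc R) (fun x y => ltac:(by case: x; case: y)) erefl S.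
have := half (@complex.Im R) (@Im_le_nc R) (fun x y => ltac:(by case: x; case: y)) erefl S.
move=> h1 h2; apply: (@le_trans _ _ (\sum_(k <- S | k \notin S0)
   (`|complex.Re (z k)| + `|complex.Im (z k)|))).
  by apply: ler_sum => k _; exact: nc_Re_Im.
by rewrite big_split /=; lra.
Qed.

(** Small tails make the net of finite sums Cauchy; completeness of the reals is applied to real and
    imaginary parts. *)
Lemma abs_summable_cvg (z : K -> R[i]) (B : R) :
  (forall S, \sum_(k <- S) nc (z k) <= B) ->
  exists l, forall e, 0 < e -> exists S, forall T, (S `<=` T)%fset ->
    nc (l - \sum_(k <- T) z k) <= e.
Proof.
move=> zB.
have tail := bounded_sums_tail (fun k => nc_ge0 (z k)) zB.
have diff S T : (S `<=` T)%fset ->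
    nc (\sum_(k <- T) z k - \sum_(k <- S) z k) <= \sum_(k <- T | k \notin S) nc (z k).
  move=> ST; rewrite (big_fsetID _ (mem S) T)/=.
  have -> : [fset x in T | x \in mem S]%fset = S.
    apply/fsetP => x; rewrite !inE /=; apply/andP/idP => [[]//|xS].
    by rewrite (fsubsetP ST).
  by rewrite addrAC subrr add0r -big_fset_condE; exact: nc_sum.
have lim (g : R[i] -> R) : (forall x, `|g x| <= nc x) ->
   (forall x y, g (x - y) = g x - g y) ->
   exists l, forall e, 0 < e -> exists S, forall T, (S `<=` T)%fset ->
    `|l - g (\sum_(k <- T) z k)| <= e.
  move=> gle gB; pose h (S : {fset K}) : R := g (\sum_(k <- S) z k).
  have : cvg (h @ totally).
    apply/cauchy_cvgP.  apply: cauchy_exP => e e0.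
    have [S HS] := tail _ (divr_gt0 e0 (ltr0n _ 2)).
    exists (h S), S => // T /= ST.
    rewrite -ball_normE /= distrC /h -gB (le_lt_trans (gle _))//.
    rewrite (le_lt_trans (diff _ _ ST))// (le_lt_trans (HS _))//; lra.
  move=> /cvg_ex[l /cvgrPdist_le hl]; exists l => e e0.
  by have [S _ HS] := hl e e0; exists S => T ST; exact: HS.
have [a Ha] := lim (@complex.Re R) (@Re_le_nc R) (fun x y => ltac:(by case: x; case: y)).
have [b Hb] := lim (@complex.Im R) (@Im_le_nc R) (fun x y => ltac:(by case: x; case: y)).
exists (a +i* b)%C => e e0.
have [S HS] := Ha _ (divr_gt0 e0 (ltr0n _ 2)).
have [S' HS'] := Hb _ (divr_gt0 e0 (ltr0n _ 2)).
exists (S `|` S')%fset => T; rewrite fsubUset => /andP[ST S'T].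
apply: le_trans (nc_Re_Im _) _.
have := HS _ ST; have := HS' _ S'T; move: (\sum_(k <- T) z k) => [x y] /=.
lra.
Qed.

(* Cauchy-Schwarz, in the form used for a product of two small factors. *)
Lemma sum_mul_le (S : {fset K}) (u v : K -> R) (X e : R) : 0 < X -> 0 < e ->
  \sum_(k <- S) u k ^+ 2 <= X -> \sum_(k <- S) v k ^+ 2 <= e ^+ 2 / X ->
  \sum_(k <- S) u k * v k <= e.
Proof.
move=> X0 e0 hu hv.
(* Weighted arithmetic-geometric mean inequality, with weights making each of the two sums
   contribute [e / 2]. *)
apply: (@le_trans _ _ (\sum_(k <- S) (e / (2 * X) * u k ^+ 2 + X / (2 * e) * v k ^+ 2))).
  apply: ler_sum => k _; rewrite -subr_ge0.
  have -> : e / (2 * X) * u k ^+ 2 + X / (2 * e) * v k ^+ 2 - u k * v k =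
     (e * u k - X * v k) ^+ 2 / (2 * X * e).
    by field; rewrite !gt_eqF.
  by rewrite divr_ge0 ?sqr_ge0// !mulr_ge0// ltW.
rewrite big_split /= -!mulr_sumr.
have h1 : e / (2 * X) * \sum_(k <- S) u k ^+ 2 <= e / (2 * X) * X.
  by rewrite ler_wpM2l// divr_ge0 ?mulr_ge0// ltW.
have h2 : X / (2 * e) * \sum_(k <- S) v k ^+ 2 <= X / (2 * e) * (e ^+ 2 / X).
  by rewrite ler_wpM2l// divr_ge0 ?mulr_ge0// ltW.
rewrite (le_trans (lerD h1 h2))// le_eqVlt; apply/orP; left; apply/eqP.
by field; rewrite !gt_eqF.
Qed.

End FiniteSums.

(** * Exponentials and the metric of the torus *)

Section Exponentials.
Context (R : realType) (n : nat).
Implicit Types (k l : 'rV[int]_n) (x y : 'rV[R]_n) (t s : torus R n).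

(** The lift of [character k] to the covering space, where points can be added and subtracted. *)
Definition expo k x : R[i] := cis (\sum_(j < n) (k 0 j)%:~R * x 0 j).

Lemma nc_expo k x : nc (expo k x) = 1. Proof. exact: nc_cis. Qed.

Lemma expoD k x y : expo k (x + y) = expo k x * expo k y.
Proof.
rewrite -cisD -big_split; congr cis; apply: eq_bigr => j _.
by rewrite mxE mulrDr.
Qed.

Lemma expo_latt k l : expo k (latt R l) = 1.
Proof.
rewrite /expo -[RHS](cis2pi R (\sum_(j < n) k 0 j * l 0 j)); congr cis.
rewrite rmorph_sum mulr_sumr; apply: eq_bigr => j _.
by rewrite /latt !mxE rmorphM mulrCA.
Qed.

Lemma expoDl k l x : expo (k + l) x = expo k x * expo l x.
Proof.
rewrite -cisD -big_split; congr cis; apply: eq_bigr => j _.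
by rewrite mxE rmorphD mulrDl.
Qed.

Lemma expoN k x : expo (- k) x = (expo k x)^*%C.
Proof.
rewrite /expo -cisN; congr cis; rewrite -sumrN; apply: eq_bigr => j _.
by rewrite mxE rmorphN mulNr.
Qed.

Lemma expo_prod k x : expo k x = \prod_(j < n) cis ((k 0 j)%:~R * x 0 j).
Proof. exact: cis_sum. Qed.

Definition tclass x : torus R n := (\pi_(torus R n) x)%qT.

Lemma repr_tclass x : exists l, repr (tclass x) = x + latt R l.
Proof.
have /eqmodP/asboolP[l ->] : (repr (tclass x) = x %[mod torus R n])%qT.
  exact: reprK.
by exists l.
Qed.

Lemma character_tclass k x : character k (tclass x) = expo k x.
Proof.
have [l xl] := repr_tclass x.
by rewrite -[LHS]/(expo k (repr _)) xl expoD expo_latt mulr1.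
Qed.

Lemma nc_character k t : nc (character k t) = 1. Proof. exact: nc_cis. Qed.

Lemma mdist_le t s l : mdist t s <= enorm (repr t - repr s + latt R l).
Proof.
apply: ge_inf; last by exists l.
by exists 0 => _ [k _ <-]; exact: enorm_ge0.
Qed.

Lemma mdist_lift t s e : 0 < e ->
  exists l, enorm (repr t - repr s + latt R l) < mdist t s + e.
Proof.
set S := [set enorm (repr t - repr s + latt R l) | l in [set: 'rV[int]_n]].
have hS : has_inf S.
  split; first by exists (enorm (repr t - repr s + latt R 0)), 0.
  by exists 0 => _ [k _ <-]; exact: enorm_ge0.
by move=> /inf_adherent/(_ hS)[_ [l _ <-] ?]; exists l.
Qed.

Lemma mdist_tclass x y l :
  mdist (tclass x) (tclass y) <= enorm (x - y + latt R l).
Proof.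
have [a xa] := repr_tclass x; have [b yb] := repr_tclass y.
have := mdist_le (tclass x) (tclass y) (l - a + b).
rewrite xa yb !lattD lattN.
rewrite (_ : x + latt R a - (y + latt R b) + (latt R l - latt R a + latt R b) =
  x - y + latt R l)//.
rewrite opprD !addrA; apply/rowP => j; rewrite !mxE; ring.
Qed.

Lemma expo_lipschitz k x :
  nc (expo k x - 1) <= enorm (map_mx intr k : 'rV[R]_n) * enorm x.
Proof.
rewrite (le_trans (nc_cis_sub1 _))//.
have cs (z : 'rV[R]_n) := enorm_CS (map_mx intr k) z.
rewrite ler_norml; apply/andP; split; last first.
  by have := cs x; under eq_bigr do rewrite mxE.
have := cs (- x); rewrite enormN lerNl -sumrN.
by under eq_bigr do rewrite !mxE mulrN.
Qed.

(** The estimate on the covering space, applied to a lift of [t - s] of nearly minimal norm. *)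
Lemma character_lipschitz k t s :
  nc (character k t - character k s) <=
  enorm (map_mx intr k : 'rV[R]_n) * mdist t s.
Proof.
set C := enorm _; have C0 : 0 <= C by exact: enorm_ge0.
apply/ler_addgt0Pr => e e0.
have e1 : 0 < e / (C + 1) by rewrite divr_gt0// ltr_wpDl.
have [l hl] := mdist_lift t s e1.
have -> : character k t - character k s =
    character k s * (expo k (repr t - repr s + latt R l) - 1).
  rewrite mulrBr mulr1; congr (_ - _).
  rewrite -[character k s]/(expo k (repr s)) -expoD addrA.
  by rewrite [repr s + _]addrC subrK expoD expo_latt mulr1.
rewrite ncM nc_character mul1r (le_trans (expo_lipschitz _ _))// -/C.
apply: (@le_trans _ _ (C * (mdist t s + e / (C + 1)))).
  by rewrite ler_wpM2l// ltW.
rewrite mulrDr lerD2l mulrA ler_pdivrMr ?ltr_wpDl// mulrC ler_wpM2l ?(ltW e0)//.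
by rewrite lerDl.
Qed.

End Exponentials.

(** * Discrete Fourier analysis on the grid *)

Section Grid.
Context (R : realType) (n : nat).
Implicit Types (k l : 'rV[int]_n) (M : nat) (a : 'rV[int]_n -> R[i]).

Definition gridpt M (s : {ffun 'I_n -> 'I_M}) : 'rV[R]_n :=
  \row_j (2 * pi * (s j)%:R / M%:R).

Definition grid_coef M (F : {ffun 'I_n -> 'I_M} -> R[i]) k : R[i] :=
  (M%:R ^+ n)^-1 * \sum_s F s * expo (- k) (gridpt s).

Definition nonzero_mod M k := [exists j, ~~ (M %| `|k ord0 j|)%N].

(** No two frequencies of [S] are aliased on the grid with [M] points per coordinate. *)
Definition separates M (S : {fset 'rV[int]_n}) :=
  forall k l, k \in S -> l \in S -> k != l -> nonzero_mod M (k - l).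

Lemma sum_expo_grid M k : (0 < M)%N -> nonzero_mod M k ->
  \sum_(s : {ffun 'I_n -> 'I_M}) expo k (gridpt s) = 0.
Proof.
move=> M0 /existsP[j Mj].
under eq_bigr do rewrite expo_prod.
transitivity (\prod_(j < n) \sum_(i < M)
    cis (2 * pi * (k 0 j)%:~R / M%:R * i%:R : R)).
  rewrite bigA_distr_bigA; apply: eq_bigr => s _; apply: eq_bigr => i _.
  by congr cis; rewrite mxE; move: (pi : R) (k 0 i)%:~R (s i)%:R (M%:R^-1) => *; ring.
by rewrite (bigD1 j)//= sum_cis_root// mul0r.
Qed.

Lemma card_grid M : #|{: {ffun 'I_n -> 'I_M}}| = (M ^ n)%N.
Proof. by rewrite card_ffun !card_ord. Qed.

Lemma grid_coef_expo M l k : (0 < M)%N -> (k != l -> nonzero_mod M (l - k)) ->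
  grid_coef (fun s => expo l (@gridpt M s)) k = (k == l)%:R.
Proof.
move=> M0 sep; have M0' : (M%:R : R[i]) ^+ n != 0 by rewrite expf_neq0 ?pnatr_eq0 -?lt0n.
rewrite /grid_coef; under eq_bigr do rewrite -expoDl.
have [->|kl] := eqVneq k l; last by rewrite sum_expo_grid ?mulr0// sep.
have expo0 x : expo (0 : 'rV[int]_n) x = 1 :> R[i].
  by rewrite /expo big1 ?cis0// => j _; rewrite mxE mul0r.
under eq_bigr do rewrite subrr expo0.
by rewrite sumr_const card_grid natrX mulVf.
Qed.

Lemma grid_coef_sum M (I : Type) (r : seq I) (c : I -> R[i])
    (F : I -> {ffun 'I_n -> 'I_M} -> R[i]) k :
  grid_coef (fun s => \sum_(i <- r) c i * F i s) k =
  \sum_(i <- r) c i * grid_coef (F i) k.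
Proof.
rewrite /grid_coef; under eq_bigr do rewrite mulr_suml.
rewrite exchange_big /= mulr_sumr; apply: eq_bigr => i _.
rewrite mulrCA; congr (_ * _); rewrite mulr_sumr; apply: eq_bigr => s _.
by rewrite mulrA.
Qed.

Lemma grid_coefB M (F G : {ffun 'I_n -> 'I_M} -> R[i]) k :
  grid_coef (fun s => F s - G s) k = grid_coef F k - grid_coef G k.
Proof.
rewrite /grid_coef -mulrBr -sumrB; congr (_ * _); apply: eq_bigr => s _.
by rewrite mulrBl.
Qed.

Lemma nc_grid_coef M (F : {ffun 'I_n -> 'I_M} -> R[i]) (B : R) k :
  (0 < M)%N -> (forall s, nc (F s) <= B) -> nc (grid_coef F k) <= B.
Proof.
move=> M0 FB; rewrite ncM ncV ncX nc_nat mulrC ler_pdivrMr; last first.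
  by rewrite exprn_gt0// ltr0n.
rewrite (le_trans (nc_sum _ _ _))//.
apply: (@le_trans _ _ (\sum_(s : {ffun 'I_n -> 'I_M}) B)).
  by apply: ler_sum => s _; rewrite ncM nc_expo mulr1.
by rewrite sumr_const card_grid -[leLHS]mulr_natr natrX.
Qed.

Lemma grid_parseval M (F : {ffun 'I_n -> 'I_M} -> R[i]) (S : {fset 'rV[int]_n})
    (c : 'rV[int]_n -> R[i]) : (0 < M)%N ->
  \sum_s F s * (\sum_(k <- S) c k * expo k (gridpt s))^*%C =
  M%:R ^+ n * \sum_(k <- S) (c k)^*%C * grid_coef F k.
Proof.
move=> M0; have M0' : (M%:R : R[i]) ^+ n != 0 by rewrite expf_neq0 ?pnatr_eq0 -?lt0n.
under eq_bigr do rewrite rmorph_sum mulr_sumr.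
rewrite exchange_big mulr_sumr; apply: eq_bigr => k _.
rewrite /grid_coef mulrCA mulVKf// mulr_sumr; apply: eq_bigr => s _.
by rewrite rmorphM expoN mulrCA.
Qed.

(** Let [P] be the partial sum of [F] over [S]. By orthogonality both the pairing of [F] with [P]
    and the square norm of [P] equal [M^n B]; bounding the pairing by half the sum of the two square
    norms gives the claim. *)
Lemma grid_bessel M (F : {ffun 'I_n -> 'I_M} -> R[i]) (S : {fset 'rV[int]_n}) :
  (0 < M)%N -> separates M S ->
  \sum_(k <- S) nc (grid_coef F k) ^+ 2 <=
  (M%:R ^+ n)^-1 * \sum_s nc (F s) ^+ 2.
Proof.
move=> M0 sep; set B := \sum_(k <- S) _.
pose P s := \sum_(k <- S) grid_coef F k * expo k (@gridpt M s).
have V0 : 0 < (M%:R : R) ^+ n by rewrite exprn_gt0// ltr0n.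
have BE : \sum_(k <- S) (grid_coef F k)^*%C * grid_coef F k = B%:C%C.
  rewrite rmorph_sum; apply: eq_bigr => k _.
  by rewrite -[RHS]/((nc (grid_coef F k) ^+ 2)%:C%C) nc_sqr mulrC.
have VE : (M%:R : R[i]) ^+ n = (M%:R ^+ n)%:C%C by rewrite rmorphXn rmorph_nat.
have FP : \sum_s F s * (P s)^*%C = (M%:R ^+ n * B)%:C%C.
  by rewrite grid_parseval// BE VE -rmorphM.
have PP : \sum_s nc (P s) ^+ 2 = M%:R ^+ n * B.
  apply: complexI; rewrite rmorph_sum /=.
  rewrite (eq_bigr (fun s => P s * (P s)^*%C)) => [|s _]; last exact: nc_sqr.
  rewrite grid_parseval// rmorphM /= -VE -BE; congr (_ * _).
  rewrite big_seq [RHS]big_seq; apply: eq_bigr => k kS; congr (_ * _).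
  rewrite grid_coef_sum big_seq.
  under eq_bigr => l lS.
    rewrite grid_coef_expo//; last by move=> kl; apply: sep; rewrite // eq_sym.
    over.
  rewrite -big_seq (big_fsetD1 k)//= eqxx mulr1 big_seq big1 ?addr0// => l.
  by rewrite !inE => /andP[lk _]; rewrite eq_sym (negbTE lk) mulr0.
have B0 : 0 <= B by apply: sumr_ge0 => k _; rewrite sqr_ge0.
have h : M%:R ^+ n * B <= \sum_s nc (F s) * nc (P s).
  have -> : M%:R ^+ n * B = nc (\sum_s F s * (P s)^*%C).
    by rewrite FP nc_real ger0_norm// mulr_ge0// ltW.
  rewrite (le_trans (nc_sum _ _ _))//; apply: ler_sum => s _.
  rewrite ncM ler_wpM2l ?nc_ge0//.
  by case: (P s) => u v /=; rewrite sqrrN.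
have h2 : \sum_s nc (F s) * nc (P s) <=
    2^-1 * (\sum_s nc (F s) ^+ 2 + \sum_s nc (P s) ^+ 2).
  rewrite -big_split mulr_sumr; apply: ler_sum => s _ /=.
  by have := sqr_ge0 (nc (F s) - nc (P s)); nra.
rewrite mulrC ler_pdivlMr// mulrC; move: h h2; rewrite PP; lra.
Qed.

(** A modulus exceeding all coordinate differences within [S] divides no nonzero one. *)
Lemma separatesP (S : {fset 'rV[int]_n}) :
  exists M0, forall M, (M0 <= M)%N -> separates M S.
Proof.
exists (\sum_(k <- S) \sum_(l <- S) \sum_j `|k ord0 j - l ord0 j|%N).+1%N.
move=> M MS k l kS lS kl.
have [j kj] : exists j, k ord0 j != l ord0 j.
  apply/existsP; rewrite -negb_forall; apply: contra kl => /forallP h.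
  by apply/eqP/rowP => j; apply/eqP.
apply/existsP; exists j; rewrite !mxE; apply/negP => /dvdn_leq.
rewrite absz_gt0 subr_eq0 kj => /(_ isT); apply/negP; rewrite -ltnNge.
apply: leq_trans MS; rewrite ltnS (big_fsetD1 k)//= (big_fsetD1 l)//= (bigD1 j)//=.
by rewrite -!addnA leq_addr.
Qed.

End Grid.

(** * Fourier series on the torus: convergence, continuity, uniqueness *)

Section FourierSeries.
Context (R : realType) (n : nat).
Implicit Types (k l : 'rV[int]_n) (a b : 'rV[int]_n -> R[i])
  (f g : torus R n -> R[i]) (t s : torus R n).

(** The norm and the radii of [R[i]^o] are complex-valued; a positive complex number is real, which
    allows a real [e] here. *)
Lemma fourier_seriesP a f : fourier_series a f <->
  forall t e, 0 < e -> exists S : {fset 'rV[int]_n}, forall T, (S `<=` T)%fset ->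
    nc (f t - \sum_(k <- T) a k * character k t) <= e.
Proof.
have ps t T : partial_sum (fun k => a k * character k t : R[i]^o) T =
    \sum_(k <- T) a k * character k t by rewrite /partial_sum big_seq_fsetE.
have normE (z : R[i]^o) (e : R) : (`|z| <= e%:C%C) = (nc z <= e).
  by rewrite -lecR; case: z => u v; rewrite normc_def.
split=> H t.
  move=> e e0; have := H t => /cvgrPdist_le /(_ (e%:C%C)).
  rewrite ltcR => /(_ e0)[S _ HS]; exists S => T /HS.
  by rewrite /= ps normE.
apply/cvgrPdist_le => eps eps0.
have [e epsE] : exists e : R, eps = e%:C%C.
  by apply/complex_realP; rewrite gtr0_real.
move: eps0; rewrite epsE ltcR => /(H t)[S HS].
by exists S => // T /HS; rewrite /= ps normE.
Qed.

Lemma fourier_series_exists a (B : R) :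
  (forall S : {fset 'rV[int]_n}, \sum_(k <- S) nc (a k) <= B) ->
  exists f, fourier_series a f.
Proof.
move=> aB.
have /choice[f Hf] : forall t, exists l : R[i], forall e, 0 < e ->
    exists S : {fset 'rV[int]_n}, forall T, (S `<=` T)%fset ->
    nc (l - \sum_(k <- T) a k * character k t) <= e.
  move=> t; apply: (@abs_summable_cvg _ _ _ B) => S.
  by under eq_bigr do rewrite ncM nc_character mulr1.
by exists f; apply/fourier_seriesP.
Qed.

Lemma fourier_series_tail a f (S : {fset 'rV[int]_n}) (e : R) t :
  fourier_series a f -> (forall T : {fset 'rV[int]_n}, \sum_(k <- T | k \notin S) nc (a k) <= e) ->
  nc (f t - \sum_(k <- S) a k * character k t) <= e.
Proof.
move=> /fourier_seriesP fa Se; apply/ler_addgt0Pl => d d0.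
have [S' HS'] := fa t d d0.
have := HS' (S `|` S')%fset (fsubsetUr _ _).
rewrite (big_fsetID _ (mem S))/=.
have -> : [fset x in (S `|` S')%fset | x \in mem S]%fset = S.
  by apply/fsetP => x; rewrite !inE /=; case: (x \in S); rewrite ?andbF.
rewrite -big_fset_condE /=.
set x := \sum_(k <- S) _; set y := \sum_(k <- _ | _) _ => h.
have -> : f t - x = (f t - (x + y)) + y by ring.
rewrite (le_trans (ncD _ _))// lerD// (le_trans _ (Se (S `|` S')%fset))//.
rewrite (le_trans (nc_sum _ _ _))//; apply: ler_sum => k _.
by rewrite ncM nc_character mulr1.
Qed.

Lemma fourier_series_bound a f (B : R) t : fourier_series a f ->
  (forall S : {fset 'rV[int]_n}, \sum_(k <- S) nc (a k) <= B) -> nc (f t) <= B.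
Proof.
move=> fa aB; have := @fourier_series_tail a f fset0 B t fa.
rewrite big_seq_fset0 subr0; apply => T.
by under eq_bigl do rewrite in_fset0.
Qed.

Lemma fourier_seriesB a b f g : fourier_series a f -> fourier_series b g ->
  fourier_series (fun k => a k - b k) (fun t => f t - g t).
Proof.
move=> /fourier_seriesP fa /fourier_seriesP gb; apply/fourier_seriesP => t e e0.
have e2 : 0 < e / 2 by rewrite divr_gt0.
have [S HS] := fa t _ e2; have [S' HS'] := gb t _ e2.
exists (S `|` S')%fset => T; rewrite fsubUset => /andP[/HS h /HS' h'].
under eq_bigr do rewrite mulrBl.
rewrite sumrB; set x := \sum_(k <- _) _ in h *; set y := \sum_(k <- _) _ in h' *.
have -> : f t - g t - (x - y) = (f t - x) - (g t - y) by ring.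
by rewrite (le_trans (ncB _ _))//; lra.
Qed.

(** A partial sum over [S] is uniformly within [e / 3] of [f] and is Lipschitz with constant [C]. *)
Lemma fourier_series_continuous a f (B : R) : fourier_series a f ->
  (forall S : {fset 'rV[int]_n}, \sum_(k <- S) nc (a k) <= B) ->
  continuous (f : torus R n -> R[i]^o).
Proof.
move=> fa aB t; have ft : Filter (nbhs t) by exact: nbhs_filter.
apply/(@cvgrPdist_le R[i] _ _ (nbhs t) ft) => eps eps0.
have [e epsE] : exists e : R, eps = e%:C%C.
  by apply/complex_realP; rewrite gtr0_real.
move: eps0; rewrite epsE ltcR => e0.
have e3 : 0 < e / 3 by rewrite divr_gt0.
have [S HS] := bounded_sums_tail (fun k => nc_ge0 (a k)) aB e3.
pose C := \sum_(k <- S) nc (a k) * enorm (map_mx intr k : 'rV[R]_n).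
have C0 : 0 <= C by apply: sumr_ge0 => k _; rewrite mulr_ge0 ?nc_ge0 ?enorm_ge0.
have d0 : 0 < e / 3 / (C + 1) by rewrite divr_gt0// ltr_wpDl.
apply/nbhs_ballP; exists (e / 3 / (C + 1)) => //= s.
rewrite ballEmdist /= => ts.
suff : nc (f t - f s) <= e.
  by rewrite -lecR; case: (f t - f s) => u v; rewrite normc_def.
have ht := fourier_series_tail t fa HS; have hs := fourier_series_tail s fa HS.
have : nc (\sum_(k <- S) a k * character k t - \sum_(k <- S) a k * character k s) <= e / 3.
  rewrite -sumrB (le_trans (nc_sum _ _ _))//.
  apply: (@le_trans _ _ (C * mdist t s)).
    rewrite mulr_suml; apply: ler_sum => k _.
    by rewrite -mulrBr ncM -mulrA ler_wpM2l ?nc_ge0 ?character_lipschitz.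
  apply: (@le_trans _ _ (C * (e / 3 / (C + 1)))); first by rewrite ler_wpM2l// ltW.
  by rewrite mulrA ler_pdivrMr ?ltr_wpDl// mulrC ler_wpM2l ?(ltW e3)// lerDl.
move: ht hs; set x := \sum_(k <- S) _; set y := \sum_(k <- S) _ => ht hs xy.
have -> : f t - f s = (f t - x) + (x - y) - (f s - y) by ring.
rewrite (le_trans (ncB _ _))//.
have := ncD (f t - x) (x - y); lra.
Qed.

Definition on_grid f M (s : {ffun 'I_n -> 'I_M}) : R[i] := f (tclass (gridpt R s)).

(* The coefficients of the restriction of f to the grid are the sums of a over
   the classes modulo M. *)
Lemma aliasing a f (B : R) k (e : R) : fourier_series a f ->
  (forall S : {fset 'rV[int]_n}, \sum_(l <- S) nc (a l) <= B) -> 0 < e ->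
  exists M0, forall M, (M0 <= M)%N -> (0 < M)%N ->
    nc (grid_coef (@on_grid f M) k - a k) <= e.
Proof.
move=> fa aB e0.
have [S HS] := bounded_sums_tail (fun k => nc_ge0 (a k)) aB e0.
(* With [k] in [S'] and no aliasing inside [S'], the partial sum [P] has grid coefficient exactly
   [a k]; the remainder is at most [e] everywhere, hence so are its grid coefficients. *)
pose S' := (k |` S)%fset.
have HS' (T : {fset 'rV[int]_n}) : \sum_(l <- T | l \notin S') nc (a l) <= e.
  rewrite (le_trans _ (HS T))// [leLHS]big_fset_condE [leRHS]big_fset_condE.
  apply: ler_sum_fsubset; first by move=> l; exact: nc_ge0.
  by apply/fsubsetP => l; rewrite !inE /= negb_or => /andP[-> /andP[]].
have [M0 HM] := separatesP S'; exists M0 => M M0M Mpos.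
have sep := HM _ M0M.
pose P (s : {ffun 'I_n -> 'I_M}) := \sum_(l <- S') a l * expo l (@gridpt R n M s).
have <- : grid_coef P k = a k.
  rewrite grid_coef_sum big_seq.
  have kS : k \in S' by rewrite !inE eqxx.
  under eq_bigr => l lS.
    rewrite grid_coef_expo//; last by move=> kl; apply: sep; rewrite // eq_sym.
    over.
  rewrite -big_seq (big_fsetD1 k)//= eqxx mulr1 big_seq big1 ?addr0// => l.
  by rewrite !inE => /andP[lk _]; rewrite eq_sym (negbTE lk) mulr0.
rewrite -grid_coefB; apply: nc_grid_coef => // s.
have := fourier_series_tail (tclass (gridpt R s)) fa HS'.
by under eq_bigr do rewrite character_tclass.
Qed.

(** Convergence at a single point already forces absolute summability. Aliasing then puts [a k]
    within any [e] of a grid coefficient of the zero function. *)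
Lemma fourier_series0_unique a : fourier_series a (fun=> 0) -> a = (fun=> 0).
Proof.
move=> a0; have [B aB] : exists B, forall S : {fset 'rV[int]_n},
    \sum_(k <- S) nc (a k) <= B.
  pose t0 : torus R n := tclass 0.
  have [B HB] : exists B, forall S : {fset 'rV[int]_n},
      \sum_(k <- S) nc (a k * character k t0) <= B.
    apply: nc_unconditional_bounded.
    have /fourier_seriesP/(_ t0 1 ltr01)[S HS] := a0.
    by exists S => T /HS; rewrite add0r ncN.
  exists B => S; rewrite (le_trans _ (HB S))//; apply: ler_sum => k _.
  by rewrite ncM nc_character mulr1.
apply/funext => k; apply: nc_le_eq0 => e e0.
have [M0 HM] := aliasing k a0 aB e0.
have := HM M0.+1 (leqnSn _) isT.
rewrite /grid_coef big1 ?mulr0 ?sub0r ?ncN// => s _.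
by rewrite /on_grid mul0r.
Qed.

Lemma fourier_series_unique a b f :
  fourier_series a f -> fourier_series b f -> a = b.
Proof.
move=> fa fb; have := fourier_seriesB fa fb.
rewrite (_ : (fun t => f t - f t) = (fun=> 0)); last first.
  by apply/funext => t; rewrite subrr.
move=> /fourier_series0_unique ab; apply/funext => k; apply/eqP.
by rewrite -subr_eq0; have /(congr1 (fun h => h k)) /= -> := ab.
Qed.

(** Uniqueness determines the value selected by [xget], so [A_norm] can be computed from any known
    expansion. *)
Lemma fourier_coefE a f : fourier_series a f -> fourier_coef f = a.
Proof.
move=> fa; have h : fourier_series (fourier_coef f) f.
  by apply: (@xgetPex _ (fun=> 0) [set a | fourier_series a f]); exists a.
exact: fourier_series_unique h fa.
Qed.

End FourierSeries.

(** * The weighted l1 norm through finite sums *)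

Section WeightedSums.
Context (R : realType) (n : nat) (alpha : R).
Implicit Types (a : 'rV[int]_n -> R[i]).

Definition weight (k : 'rV[int]_n) : R :=
  (1 + enorm (map_mx intr k : 'rV[R]_n)) `^ alpha.

Lemma weight_ge0 k : 0 <= weight k. Proof. exact: powR_ge0. Qed.

Lemma weight_ge1 k : 0 <= alpha -> 1 <= weight k.
Proof.
move=> a0; rewrite -[leLHS](powRr0 (1 + enorm (map_mx intr k : 'rV[R]_n))).
by rewrite ler_powR// lerDl enorm_ge0.
Qed.

Lemma weighted_l1_le a (B : R) : (weighted_l1 alpha a <= B%:E)%E <->
  forall S : {fset 'rV[int]_n}, \sum_(k <- S) nc (a k) * weight k <= B.
Proof.
split=> [H S|H].
  rewrite -lee_fin -sumEFin (le_trans _ H)// /weighted_l1.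
  apply: esum_ge; exists [set` S].
    by split => //; exact: finite_fset.
  by rewrite fsbig_finite//= set_fsetK.
rewrite /weighted_l1; apply: ge_ereal_sup => _ [A [finA _] <-].
by rewrite fsbig_finite//= sumEFin lee_fin.
Qed.

Lemma weighted_l1_finite a : (weighted_l1 alpha a < +oo)%E ->
  exists B : R, forall S : {fset 'rV[int]_n}, \sum_(k <- S) nc (a k) * weight k <= B.
Proof.
move=> afin; exists (fine (weighted_l1 alpha a)).
apply/weighted_l1_le; rewrite fineK// ge0_fin_numE//.
by apply: esum_ge0 => k _; rewrite lee_fin mulr_ge0 ?nc_ge0 ?powR_ge0.
Qed.

End WeightedSums.

(** * Cubes of frequencies *)

Section Boxes.
Context (R : realType) (n : nat).
Implicit Types (K : nat) (S : {fset 'rV[int]_n}).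

Definition boxrow K (g : {ffun 'I_n -> 'I_(2 * K).+1}) : 'rV[int]_n :=
  \row_j ((g j)%:Z - K%:Z).

(** The cubes [[-K, K]^n]: finite sets that eventually contain any given one, and over which sums of
    tensor products factorize. *)
Definition box K : {fset 'rV[int]_n} :=
  [fset boxrow g | g in [set: {ffun 'I_n -> 'I_(2 * K).+1}]%SET]%fset.

Lemma boxrow_inj K : injective (@boxrow K).
Proof.
move=> g h /rowP gh; apply/ffunP => j; have := gh j; rewrite !mxE => /addIr.
by move=> [] /val_inj.
Qed.

Lemma mem_box K (k : 'rV[int]_n) : (forall j, (`|k ord0 j| <= K)%N) -> k \in box K.
Proof.
move=> kK; apply/imfsetP => /=.
exists [ffun j => inord `|(k ord0 j + K%:Z)%R|%N]; first by rewrite inE.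
apply/rowP => j; rewrite mxE ffunE; have := kK j; rewrite -[ord0]/(0 : 'I_1).
by move: (k 0 j) => z zK; rewrite inordK; lia.
Qed.

Lemma fsubset_box S : exists K0, forall K, (K0 <= K)%N -> (S `<=` box K)%fset.
Proof.
exists (\sum_(k <- S) \sum_j `|k ord0 j|)%N => K SK.
apply/fsubsetP => k kS; apply: mem_box => j; apply: leq_trans SK.
by rewrite (big_fsetD1 k)//= (bigD1 j)//= -addnA leq_addr.
Qed.

Lemma sum_box_prod (A : comNzRingType) (F : 'I_n -> int -> A) K :
  \sum_(k <- box K) \prod_j F j (k ord0 j) =
  \prod_j \sum_(i < (2 * K).+1) F j (i%:Z - K%:Z).
Proof.
rewrite bigA_distr_bigA /box big_imfset /=; last first.
  by move=> g h _ _; exact: boxrow_inj.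
rewrite big_enum_cond /=; apply: eq_big => [g|g _]; first by rewrite inE.
by apply: eq_bigr => j _; rewrite mxE.
Qed.

Lemma sum_prod_le (u : int -> R) (U : R) S : (forall k, 0 <= u k) ->
  (forall K, \sum_(i < (2 * K).+1) u (i%:Z - K%:Z) <= U) ->
  \sum_(k <- S) \prod_j u (k ord0 j) <= U ^+ n.
Proof.
move=> u0 uU; have [K0 /(_ _ (leqnn _)) SK] := fsubset_box S.
apply: le_trans (ler_sum_fsubset _ SK) _ => [k|]; first exact: prodr_ge0.
rewrite (sum_box_prod (fun=> u)) prodr_const card_ord lerXn2r ?nnegrE//.
  exact: sumr_ge0.
by rewrite (le_trans _ (uU 0%N))// sumr_ge0.
Qed.

End Boxes.

(** * The Euclidean norm against the coordinates *)

Section EnormSum.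
Context (R : realType) (n : nat).

Lemma enorm_le_sum (x : 'rV[R]_n) : enorm x <= \sum_j `|x 0 j|.
Proof.
have s0 : 0 <= \sum_j `|x 0 j| by exact: sumr_ge0.
rewrite -(@ler_pXn2r _ 2)// ?nnegrE ?enorm_ge0// sqr_enorm expr2 mulr_suml.
apply: ler_sum => j _; rewrite -real_normK ?num_real// expr2 ler_wpM2l//.
by rewrite (bigD1 j)//= lerDl sumr_ge0.
Qed.

Lemma prod1D_ge (x : 'I_n -> R) : (forall j, 0 <= x j) ->
  1 + \sum_j x j <= \prod_j (1 + x j).
Proof.
move=> x0; suff : 1 + \sum_j x j <= \prod_j (1 + x j) /\ 0 <= \sum_j x j by case.
elim/big_rec2 : _ => [|j y z _ [h z0]]; first by rewrite addr0.
split; last by rewrite addr_ge0.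
by have := x0 j; nra.
Qed.

End EnormSum.

(** * The spline kernel: size, weighted sums and support *)

Section Kernel.
Context (R : realType) (n : nat) (p : nat).
Implicit Types (k : 'rV[int]_n) (q : nat) (S : {fset 'rV[int]_n}).

(* Fourier coefficients of a tensor product of B-splines of order p supported
   in the cube [0, 2 pi p / q]^n. *)
Definition kcoef q k : R[i] := \prod_j arc_coef R q (k ord0 j) ^+ p.

(** Up to a factor 2 this is [min (1, q / |r|)], in a form convenient for products. *)
Definition decay q (r : int) : R := q%:R / (q%:R + `|r|%:~R).

Lemma nc_arcX q r : nc (arc_coef R q r ^+ p) <= 1.
Proof. by rewrite ncX exprn_ile1 ?nc_ge0 ?nc_arc_coef. Qed.

Lemma nc_kcoef q k : nc (kcoef q k) <= 1.
Proof. by rewrite nc_prod prodr_ile1// => j _; rewrite nc_ge0 nc_arcX. Qed.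

Lemma kcoef_sub1 k : exists C, 0 <= C /\
  forall q, (0 < q)%N -> nc (kcoef q k - 1) <= C / q%:R.
Proof.
exists (\sum_j p%:R * (2 * (2 * pi * `|k ord0 j|%:~R))); split.
  by apply: sumr_ge0 => j _; rewrite !mulr_ge0 ?pi_ge0 ?ler0z.
move=> q q0; rewrite -[X in _ - X](@big1 _ 1 *%R 'I_n (index_enum _) xpredT (fun=> 1))//.
rewrite (le_trans (nc_sub_prod _ _ _))//.
- by move=> j; exact: nc_arcX.
- by move=> j; rewrite nc1.
rewrite mulr_suml; apply: ler_sum => j _.
rewrite -[X in _ - X](expr1n _ p) (le_trans (nc_sub_exp _ _ _)) ?nc_arc_coef ?nc1//.
rewrite -[leRHS]mulrA ler_wpM2l// (le_trans (nc_arc_coef_sub1 _ _ _))//.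
by rewrite norm_angle -[leRHS]mulrA.
Qed.

Lemma decay_gt0 q r : (0 < q)%N -> 0 < decay q r.
Proof. by move=> q0; rewrite divr_gt0 ?ltr_wpDr ?ler0z ?ltr0n. Qed.

Lemma decay_ge0 q r : 0 <= decay q r.
Proof. by rewrite divr_ge0 ?addr_ge0 ?ler0z. Qed.

Lemma decay_le1 q r : (0 < q)%N -> decay q r <= 1.
Proof.
move=> q0; rewrite ler_pdivrMr ?ltr_wpDr ?ler0z ?ltr0n// mul1r.
by rewrite lerDl ler0z.
Qed.

Lemma nc_arc_decay q r : (0 < q)%N -> nc (arc_coef R q r) <= 2 * decay q r.
Proof.
move=> q0; rewrite mulrA ler_pdivlMr ?ltr_wpDr ?ler0z ?ltr0n// mulrDr.
have := nc_arc_coef_decay R r q0.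
have : nc (arc_coef R q r) * q%:R <= q%:R by rewrite ler_piMl ?nc_arc_coef.
lra.
Qed.

Lemma sum_decay q K : (0 < q)%N ->
  \sum_(i < (2 * K).+1) decay q (i%:Z - K%:Z) ^+ 2 <= 3 * q%:R.
Proof.
move=> q0; have qR : (0 : R) < q%:R by rewrite ltr0n.
have q1 : (1 : R) <= q%:R by rewrite ler1n.
(* The telescoped bound is what induction on [K] carries; each step adds the two terms with
   [|r| = K + 1]. *)
suff : \sum_(i < (2 * K).+1) decay q (i%:Z - K%:Z) ^+ 2 <=
    1 + 2 * q%:R ^+ 2 * (q%:R^-1 - (q%:R + K%:R)^-1).
  move/le_trans; apply.
  apply: (@le_trans _ _ (1 + 2 * q%:R ^+ 2 * q%:R^-1)).
    by rewrite lerD2l ler_wpM2l ?mulr_ge0 ?sqr_ge0// gerBl invr_ge0 addr_ge0.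
  by rewrite expr2 mulrA mulfK ?gt_eqF//; lra.
elim: K => [|K IH].
  rewrite big_ord1 /decay subrr normr0 mulr0z !addr0 divff ?gt_eqF// expr1n.
  by rewrite subrr mulr0 addr0.
have -> : (2 * K.+1).+1 = (2 * K).+3 by lia.
rewrite big_ord_recl big_ord_recr /=.
have -> : \sum_(i < (2 * K).+1) decay q ((lift ord0 (widen_ord (leqnSn _) i))%:Z - K.+1%:Z) ^+ 2
   = \sum_(i < (2 * K).+1) decay q (i%:Z - K%:Z) ^+ 2.
  by apply: eq_bigr => i _; congr (decay _ _ ^+ 2); rewrite /= /bump /=; lia.
have d1 : decay q (0%:Z - K.+1%:Z) = q%:R / (q%:R + K.+1%:R).
  by rewrite /decay sub0r normrN.
have d2 : decay q ((bump 0 (2 * K).+1)%:Z - K.+1%:Z) = q%:R / (q%:R + K.+1%:R).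
  by rewrite /decay /bump /= (_ : _ - _ = K.+1%:Z); last by lia.
rewrite d1 d2.
have a1 : 1 < q%:R + K.+1%:R :> R by rewrite -natrD ltr1n; lia.
have := inv_sqr_telescope a1.
have -> : q%:R + K.+1%:R - 1 = q%:R + K%:R :> R by rewrite -natr1; ring.
move/(ler_wpM2l (sqr_ge0 q%:R)); rewrite expr_div_n mulrBr => h.
move: IH h; move: (\sum_(i < _) _) (q%:R ^+ 2 / (q%:R + K.+1%:R) ^+ 2) => s z.
move: (q%:R ^+ 2) ((q%:R + K%:R)^-1) ((q%:R + K.+1%:R)^-1) (q%:R^-1) => Q A B C.
lra.
Qed.

(** With [D] the product of the decay factors, the coefficient is at most [2^(p n) D^p], while [1 +
    |k| <= q prod_j (1 + |k_j| / q) = q / D]. This leaves [D^(p - alpha)], at most [D^2] because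
    [D <= 1] and [p >= alpha + 2]. *)
Lemma nc_kcoef_weight (alpha : R) q k : 0 <= alpha -> alpha + 2 <= p%:R ->
  (0 < q)%N ->
  nc (kcoef q k) * weight alpha k <=
  2 ^+ (p * n) * q%:R `^ alpha * \prod_j decay q (k ord0 j) ^+ 2.
Proof.
move=> a0 ap q0; have qR : (0 : R) < q%:R by rewrite ltr0n.
have q1 : (1 : R) <= q%:R by rewrite ler1n.
pose D := \prod_j decay q (k ord0 j).
have D0 : 0 < D by apply: prodr_gt0 => j _; exact: decay_gt0.
have D1 : D <= 1.
  by rewrite prodr_ile1// => j _; rewrite decay_ge0 decay_le1.
have cD : nc (kcoef q k) <= 2 ^+ (p * n) * D ^+ p.
  have -> : 2 ^+ (p * n) * D ^+ p = \prod_j (2 * decay q (k ord0 j)) ^+ p.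
    by rewrite prodrXl big_split prodr_const card_ord exprMn -exprM mulnC.
  rewrite nc_prod; apply: ler_prod => j _ /=.
  by rewrite nc_ge0 ncX lerXn2r ?nnegrE ?nc_ge0 ?mulr_ge0 ?decay_ge0 ?nc_arc_decay.
have wD : weight alpha k <= q%:R `^ alpha * D `^ (- alpha).
  have -> : D `^ (- alpha) = D^-1 `^ alpha.
    by rewrite -powR_inv1 ?(ltW D0)// -powRrM mulN1r.
  rewrite -powRM ?invr_ge0 ?(ltW D0)//; apply: ge0_ler_powR => //.
  - by rewrite nnegrE addr_ge0 ?enorm_ge0.
  - by rewrite nnegrE mulr_ge0 ?invr_ge0 ?ltW.
  apply: (@le_trans _ _ (q%:R * (1 + \sum_j `|k ord0 j|%:~R / q%:R))).
    rewrite mulrDr mulr1 lerD// (le_trans (enorm_le_sum _))// mulr_sumr.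
    apply: ler_sum => j _; rewrite !mxE mulrCA divff ?gt_eqF// mulr1.
    by rewrite intr_norm.
  rewrite ler_pM2l//; apply: le_trans (prod1D_ge _) _ => [j|].
    by rewrite divr_ge0 ?ler0z.
  rewrite /D -prodfV; apply: ler_prod => j _.
  rewrite addr_ge0 ?divr_ge0 ?ler0z//= /decay invf_div mulrDl divff ?gt_eqF//.
rewrite (le_trans (ler_pM (nc_ge0 _) (weight_ge0 _ _) cD wD))//.
rewrite mulrACA ler_wpM2l ?mulr_ge0 ?exprn_ge0 ?powR_ge0//.
rewrite prodrXl -/D -!powR_mulrn ?(ltW D0)// -powRD; last by rewrite (gt_eqF D0) implybT.
by apply: ger_powR; rewrite ?D0//; lra.
Qed.

Lemma sum_kcoef_weight (alpha : R) q S : 0 <= alpha -> alpha + 2 <= p%:R ->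
  (0 < q)%N ->
  \sum_(k <- S) nc (kcoef q k) * weight alpha k <=
  2 ^+ (p * n) * q%:R `^ alpha * (3 * q%:R) ^+ n.
Proof.
move=> a0 ap q0.
apply: (@le_trans _ _ (2 ^+ (p * n) * q%:R `^ alpha *
    \sum_(k <- S) \prod_j decay q (k ord0 j) ^+ 2)).
  by rewrite mulr_sumr; apply: ler_sum => k _; exact: nc_kcoef_weight.
rewrite ler_wpM2l ?mulr_ge0 ?exprn_ge0 ?powR_ge0//.
apply: (@sum_prod_le _ _ (fun r => decay q r ^+ 2)) => [r|K]; first exact: sqr_ge0.
exact: sum_decay.
Qed.

(** The product of squared decay factors is at most 1, so its square is at most itself and its sum
    costs only [q^n]. The order is [q^(2 alpha + n)], which Cauchy-Schwarz needs. *)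
Lemma sum_kcoef_weight_sqr (alpha : R) q S : 0 <= alpha -> alpha + 2 <= p%:R ->
  (0 < q)%N ->
  \sum_(k <- S) (nc (kcoef q k) * weight alpha k) ^+ 2 <=
  (2 ^+ (p * n) * q%:R `^ alpha) ^+ 2 * (3 * q%:R) ^+ n.
Proof.
move=> a0 ap q0.
apply: (@le_trans _ _ ((2 ^+ (p * n) * q%:R `^ alpha) ^+ 2 *
    \sum_(k <- S) \prod_j decay q (k ord0 j) ^+ 2)); last first.
  rewrite ler_wpM2l ?sqr_ge0//.
  apply: (@sum_prod_le _ _ (fun r => decay q r ^+ 2)) => [r|K]; first exact: sqr_ge0.
  exact: sum_decay.
rewrite mulr_sumr; apply: ler_sum => k _.
set P := \prod_j decay q (k ord0 j) ^+ 2.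
have P0 : 0 <= P by apply: prodr_ge0 => j _; exact: sqr_ge0.
have P1 : P <= 1.
  by rewrite prodr_ile1// => j _; rewrite sqr_ge0/= exprn_ile1 ?decay_ge0 ?decay_le1.
have h : nc (kcoef q k) * weight alpha k <= 2 ^+ (p * n) * q%:R `^ alpha * P.
  exact: nc_kcoef_weight.
have h2 : (nc (kcoef q k) * weight alpha k) ^+ 2 <=
    (2 ^+ (p * n) * q%:R `^ alpha * P) ^+ 2.
  by rewrite lerXn2r ?nnegrE ?mulr_ge0 ?nc_ge0 ?weight_ge0 ?exprn_ge0 ?powR_ge0.
by rewrite (le_trans h2)// exprMn ler_wpM2l ?sqr_ge0// expr2 ler_piMl.
Qed.

(** The sum over a cube factorizes. Modulo [2 pi], coordinate [j] is off the support, so its factor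
    is [O(q^2 / K)]; each other factor is at most [12 q], whatever [K] is. *)
Lemma kernel_vanish q (x : 'rV[R]_n) j (l : int) : (0 < q)%N -> (1 < p)%N ->
  2 * pi * p%:R / q%:R <= x 0 j + 2 * pi * l%:~R ->
  x 0 j + 2 * pi * l%:~R < 2 * pi ->
  forall e, 0 < e -> exists K0, forall K, (K0 <= K)%N ->
    nc (\sum_(k <- box n K) kcoef q k * expo k x) <= e.
Proof.
move=> q0 p1 xj1 xj2 e e0; have qR : (0 : R) < q%:R by rewrite ltr0n.
have q1 : (1 : R) <= q%:R by rewrite ler1n.
pose C : R := (12 * q%:R) ^+ n * (2 * q%:R ^+ 2).
have C0 : 0 < C by rewrite mulr_gt0 ?exprn_gt0 ?mulr_gt0 ?exprn_gt0.
exists (Num.truncn (C / e)).+1 => K KC.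
have K0 : (0 < K)%N by exact: leq_trans KC.
have KR : (0 : R) < K%:R by rewrite ltr0n.
have CK : C / K%:R <= e.
  rewrite ler_pdivrMr// mulrC -ler_pdivrMr// (le_trans (ltW (truncnS_gt _)))//.
  by rewrite ler_nat.
pose F (i : 'I_n) (r : int) : R[i] := arc_coef R q r ^+ p * cis (r%:~R * x 0 i).
have -> : \sum_(k <- box n K) kcoef q k * expo k x =
    \prod_i \sum_(r < (2 * K).+1) F i (r%:Z - K%:Z).
  rewrite -sum_box_prod; apply: eq_bigr => k _.
  by rewrite expo_prod -big_split.
rewrite nc_prod (bigD1 j)//= mulrC (le_trans _ CK)// /C.
have h1 : \prod_(i < n | i != j) nc (\sum_(r < (2 * K).+1) F i (r%:Z - K%:Z)) <=
    (12 * q%:R) ^+ n.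
  apply: (@le_trans _ _ (\prod_(i < n | i != j) (12 * q%:R))).
    apply: ler_prod => i _; rewrite nc_ge0/= (le_trans (nc_sum _ _ _))//.
    apply: (@le_trans _ _ (\sum_(r < (2 * K).+1) 4 * decay q (r%:Z - K%:Z) ^+ 2)).
      apply: ler_sum => r _; rewrite ncM nc_cis mulr1 ncX -(subnK p1) exprD.
      rewrite (@le_trans _ _ (nc (arc_coef R q (r%:Z - K%:Z)) ^+ 2))//.
        by rewrite ler_piMl ?sqr_ge0// exprn_ile1 ?nc_ge0 ?nc_arc_coef.
      rewrite (_ : 4 = 2 ^+ 2) -?exprMn; last by ring.
      by rewrite lerXn2r ?nnegrE ?nc_ge0 ?mulr_ge0 ?decay_ge0 ?nc_arc_decay.
    by rewrite -mulr_sumr; have := sum_decay K q0; lra.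
  rewrite prodr_const ler_weXn2l//; first lra.
  by rewrite -[leqRHS](card_ord n) max_card.
have h2 : nc (\sum_(r < (2 * K).+1) F j (r%:Z - K%:Z)) <= 2 * q%:R ^+ 2 / K%:R.
  have := arc_coef_vanish q0 p1 K0 xj1 xj2; apply: le_trans.
  rewrite le_eqVlt; apply/orP; left; apply/eqP; congr nc; apply: eq_bigr => r _.
  rewrite /F mulrDr cisD; set y := (r%:Z - K%:Z); congr (_ * _).
  rewrite -[LHS]mulr1; congr (_ * _); rewrite -[LHS](cis2pi R (y * l)); congr cis.
  by rewrite rmorphM /=; ring.
by rewrite -mulrA ler_pM ?nc_ge0// prodr_ge0// => i _; exact: nc_ge0.
Qed.

End Kernel.

(** * The spline approximant: support and error *)

Section Approximation.
Context (R : realType) (n : nat).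
Implicit Types (k : 'rV[int]_n) (p q M : nat).

Lemma ler_sum_split (K : choiceType) (u : K -> R) (S0 : {fset K}) (x y : R) :
  (forall k : K, 0 <= u k) -> \sum_(k <- S0) u k <= x ->
  (forall T : {fset K}, \sum_(k <- T | k \notin S0) u k <= y) ->
  forall S : {fset K}, \sum_(k <- S) u k <= x + y.
Proof.
move=> u0 ux uy S; rewrite (big_fsetID _ (mem S0) S)/= lerD//; last first.
  by rewrite -big_fset_condE.
rewrite (le_trans _ ux)//; apply: ler_sum_fsubset => //.
by apply/fsubsetP => k; rewrite !inE /= => /andP[].
Qed.

Lemma eventually_fset (K : choiceType) (P : K -> nat -> Prop) (S : {fset K}) :
  (forall k : K, exists m0, forall m, (m0 <= m)%N -> P k m) ->
  exists m0, forall m, (m0 <= m)%N -> forall k : K, k \in S -> P k m.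
Proof.
move=> /choice[h hP]; exists (\sum_(k <- S) h k)%N => m hm k kS; apply: hP.
by apply: leq_trans hm; rewrite (big_fsetD1 k)//= leq_addr.
Qed.

(** Shift every coordinate of the difference into [[0, 2 pi)]. If all were below [h], the sum of the
    coordinates, hence the distance, would be at most [n h]. *)
Lemma far_coordinate (t : torus R n) (y : 'rV[R]_n) (h : R) :
  n%:R * h < mdist t (tclass y) ->
  exists j (l : int), h <= (repr t - y) 0 j + 2 * pi * l%:~R /\
    (repr t - y) 0 j + 2 * pi * l%:~R < 2 * pi.
Proof.
move=> ty; have p0 : 0 < 2 * pi :> R by rewrite mulr_gt0 ?pi_gt0.
set x := repr t - y.
pose l j : int := - Num.floor (x 0 j / (2 * pi)).
have lP j : 0 <= x 0 j + 2 * pi * (l j)%:~R < 2 * pi.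
  have /andP[] := floor_itv (x 0 j / (2 * pi)).
  rewrite ler_pdivlMr// ltr_pdivrMr// /l rmorphN rmorphD /= mulrDl mul1r.
  by rewrite [_%:~R * _]mulrC mulrN; lra.
have [j hj] : exists j, h <= x 0 j + 2 * pi * (l j)%:~R.
  apply: contrapT => /forallNP H; move: ty; apply/negP; rewrite -leNgt.
  have := mdist_tclass (repr t) y (\row_j l j); rewrite /tclass reprK => /le_trans; apply.
  have -> : n%:R * h = \sum_(j < n) h by rewrite sumr_const card_ord mulr_natl.
  rewrite (le_trans (enorm_le_sum _))// ler_sum// => j _.
  have -> : (repr t - y + latt R (\row_j l j)) 0 j = x 0 j + 2 * pi * (l j)%:~R.
    by rewrite mxE /latt !mxE.
  have /andP[l0 _] := lP j; rewrite ger0_norm//.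
  by have /negP := H j; rewrite -ltNge => /ltW.
by exists j, (l j); split=> //; have /andP[] := lP j.
Qed.

(** [g] is the grid convolution of [F] with the kernel: its value at [t] combines kernel values at
    [t - s] with [F s] nonzero, and these vanish in the limit by [far_coordinate] and
    [kernel_vanish]. *)
Lemma approximant_vanish p q M (F : {ffun 'I_n -> 'I_M} -> R[i])
    (g : torus R n -> R[i]) (t : torus R n) :
  (0 < q)%N -> (1 < p)%N -> (0 < M)%N ->
  fourier_series (fun k => kcoef R p q k * grid_coef F k) g ->
  (forall s, F s != 0 ->
    n%:R * (2 * pi * p%:R / q%:R) < mdist t (tclass (gridpt R s))) ->
  g t = 0.
Proof.
move=> q0 p1 M0 /fourier_seriesP gF far; apply: nc_le_eq0 => e e0.
have e2 : 0 < e / 2 by rewrite divr_gt0.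
have [S HS] := gF t _ e2; have [K1 HK1] := fsubset_box S.
pose B := \sum_s nc (F s); have B0 : 0 <= B by apply: sumr_ge0 => s _; exact: nc_ge0.
pose d := e / 2 / (B + 1); have d0 : 0 < d by rewrite divr_gt0// ltr_wpDl.
pose Q (s : {ffun 'I_n -> 'I_M}) K := F s != 0 ->
  nc (\sum_(k <- box n K) kcoef R p q k * expo k (repr t - gridpt R s)) <= d.
have [K2 HK2] : exists K2, forall K, (K2 <= K)%N -> forall s, Q s K.
  have /choice[h hP] : forall s, exists K0, forall K, (K0 <= K)%N -> Q s K.
    move=> s; have [Fs|Fs] := eqVneq (F s) 0; first by exists 0%N => K _; rewrite /Q Fs eqxx.
    have [j [l [l1 l2]]] := far_coordinate (far s Fs).
    have [K0 HK0] := kernel_vanish q0 p1 l1 l2 d0.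
    by exists K0 => K hK _; exact: HK0.
  exists (\sum_s h s)%N => K hK s; apply: hP; apply: leq_trans hK.
  by rewrite (bigD1 s)//= leq_addr.
pose K := (K1 + K2)%N.
have := HS _ (HK1 K (leq_addr _ _)).
set P := \sum_(k <- _) _ => gP.
have -> : g t = (g t - P) + P by rewrite subrK.
rewrite (le_trans (ncD _ _))// [leRHS]splitr lerD//.
(* Exchanging the sums over frequencies and grid points gives the convolution form. *)
have -> : P = (M%:R ^+ n)^-1 * \sum_s F s *
    \sum_(k <- box n K) kcoef R p q k * expo k (repr t - gridpt R s).
  rewrite [in RHS]mulr_sumr /P; under [RHS]eq_bigr do rewrite !mulr_sumr.
  rewrite [RHS]exchange_big /=; apply: eq_bigr => k _.
  rewrite /grid_coef !mulr_sumr mulr_suml; apply: eq_bigr => s _.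
  rewrite -[character k t]/(expo k (repr t)) expoD expoN.
  have -> : expo k (- gridpt R s) = (expo k (gridpt R s))^*%C.
    rewrite -expoN /expo; congr cis; apply: eq_bigr => j _.
    by rewrite !mxE rmorphN mulrN mulNr.
  by ring.
have M1 : 1 <= (M%:R : R) ^+ n by rewrite exprn_ege1// ler1n.
rewrite ncM ncV ncX nc_nat (@le_trans _ _ (B * d))//; last first.
  by rewrite /d mulrA ler_pdivrMr ?ltr_wpDl// mulrC ler_wpM2l ?(ltW e2)// lerDl.
rewrite (@le_trans _ _ (nc (\sum_s F s *
    \sum_(k <- box n K) kcoef R p q k * expo k (repr t - gridpt R s))))//.
  by rewrite ler_piMl ?nc_ge0// invf_le1// (lt_le_trans ltr01).
rewrite (le_trans (nc_sum _ _ _))// /B mulr_suml; apply: ler_sum => s _.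
have [->|Fs] := eqVneq (F s) 0; first by rewrite mul0r nc0 mul0r.
by rewrite ncM ler_wpM2l ?nc_ge0//; apply: HK2 => //; rewrite leq_addl.
Qed.

Definition far_part (f : torus R n -> R[i]) M (near : pred {ffun 'I_n -> 'I_M}) s :=
  if near s then 0 else on_grid f s.

(** The bound of [sum_kcoef_weight_sqr]. *)
Definition energy_scale (alpha : R) p q : R :=
  (2 ^+ (p * n) * q%:R `^ alpha) ^+ 2 * (3 * q%:R) ^+ n.

(** Write [c] for the kernel coefficient, [fh] and [nh] for the grid coefficients of [f] and of its
    part on [near]. The error is [- a (c - 1) - c (fh - a) + c nh]. The first term costs [2 e]; the
    other two cost [e] each on a finite set [S2] and [e] together off it. *)
Lemma approximant_error (alpha : R) p (a : 'rV[int]_n -> R[i])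
    (f : torus R n -> R[i]) (B e : R) :
  0 <= alpha -> alpha + 2 <= p%:R -> fourier_series a f ->
  (forall S : {fset 'rV[int]_n}, \sum_(k <- S) nc (a k) * weight alpha k <= B) ->
  0 < e ->
  exists q0, forall q, (q0 <= q)%N -> (0 < q)%N ->
  exists M0, forall M, (M0 <= M)%N -> (0 < M)%N ->
  forall near : pred {ffun 'I_n -> 'I_M},
    (M%:R ^+ n)^-1 * \sum_(s | near s) nc (on_grid f s) ^+ 2 <=
      e ^+ 2 / energy_scale alpha p q ->
    forall S : {fset 'rV[int]_n},
    \sum_(k <- S) nc (a k - kcoef R p q k * grid_coef (far_part f near) k)
      * weight alpha k <= 5 * e.
Proof.
move=> a0 ap fa aB e0; have e2 : 0 < e / 2 by rewrite divr_gt0.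
have w0 := @weight_ge0 R n alpha.
have aw0 k : 0 <= nc (a k) * weight alpha k by rewrite mulr_ge0 ?nc_ge0.
have aB' (S : {fset 'rV[int]_n}) : \sum_(k <- S) nc (a k) <= B.
  rewrite (le_trans _ (aB S))//; apply: ler_sum => k _.
  by rewrite ler_peMr ?nc_ge0// weight_ge1.
have B0 : 0 <= B by have := aB' fset0; rewrite big_seq_fset0.
have [S1 HS1] := bounded_sums_tail aw0 aB e2.
have /choice[C HC] := @kcoef_sub1 R n p.
pose D := \sum_(k <- S1) nc (a k) * weight alpha k * C k.
have D0 : 0 <= D by apply: sumr_ge0 => k _; rewrite mulr_ge0 ?aw0 ?(HC k).1.
exists (Num.truncn (D / e)).+1 => q qD q0.
have qR : (0 : R) < q%:R by rewrite ltr0n.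
(* On [S1] the coefficients [c] are close to 1 for large [q]; off [S1] one has [|c - 1| <= 2] and
   the tail of [a] is at most [e / 2]. *)
have T1 (S : {fset 'rV[int]_n}) :
    \sum_(k <- S) nc (a k) * weight alpha k * nc (kcoef R p q k - 1) <= e + e.
  apply: ler_sum_split => [k||T]; first by rewrite mulr_ge0 ?nc_ge0.
    apply: (@le_trans _ _ (D / q%:R)).
      rewrite /D mulr_suml; apply: ler_sum => k _; rewrite -[leRHS]mulrA.
      by rewrite ler_wpM2l// (HC k).2.
    rewrite ler_pdivrMr// mulrC -ler_pdivrMr// (le_trans (ltW (truncnS_gt _)))//.
    by rewrite ler_nat.
  have := ler_wpM2r (ler0n R 2) (HS1 T); rewrite divfK// => /(le_trans _); apply.
  rewrite mulr_suml; apply: ler_sum => k _; rewrite ler_wpM2l//.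
  by rewrite (le_trans (ncB _ _))// nc1 -[leRHS]/(1 + 1) lerD2r nc_kcoef.
set X := energy_scale alpha p q.
pose cw k := nc (kcoef R p q k) * weight alpha k.
have cw0 k : 0 <= cw k by rewrite mulr_ge0 ?nc_ge0.
have X0 : 0 < X.
  by rewrite !mulr_gt0 ?exprn_gt0 ?mulr_gt0 ?exprn_gt0 ?powR_gt0.
pose V := 2 ^+ (p * n) * q%:R `^ alpha * (3 * q%:R) ^+ n.
have cwV (S : {fset 'rV[int]_n}) : \sum_(k <- S) cw k <= V by exact: sum_kcoef_weight.
have V0 : 0 <= V by have := cwV fset0; rewrite big_seq_fset0.
(* Off [S2] the coefficients [fh], [a] and [nh] are each bounded by [B], whence [3 * B]. Adding 1
   keeps the denominators positive. *)
have eB : 0 < e / (3 * B + 1) by rewrite divr_gt0// ltr_wpDl// mulr_ge0.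
have eV : 0 < e / (V + 1) by rewrite divr_gt0// ltr_wpDl.
have [S2 HS2] := bounded_sums_tail cw0 cwV eB.
have [M1 HM1] := separatesP S2.
have [M2 HM2] := eventually_fset S2 (fun k => aliasing k fa aB' eV).
exists (M1 + M2)%N => M MM M0 near En.
have sep := HM1 M (leq_trans (leq_addr _ _) MM).
have alia := HM2 M (leq_trans (leq_addl _ _) MM).
pose N s := if near s then @on_grid R n f M s else 0.
have fb t : nc (f t) <= B by exact: fourier_series_bound fa aB'.
have farE k : grid_coef (far_part f near) k =
    grid_coef (@on_grid R n f M) k - grid_coef N k.
  rewrite -grid_coefB /grid_coef; congr (_ * _); apply: eq_bigr => s _.
  by rewrite /far_part /N; case: ifP => _; rewrite ?subrr ?subr0.
have Nb k : nc (grid_coef N k) <= B.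
  by apply: nc_grid_coef => // s; rewrite /N; case: ifP => _; [exact: fb|rewrite nc0].
have fhb k : nc (grid_coef (@on_grid R n f M) k) <= B.
  by apply: nc_grid_coef => // s; exact: fb.
have ab k : nc (a k) <= B by have := aB' [fset k]%fset; rewrite big_seq_fset1.
pose t2 k := cw k * (nc (grid_coef (@on_grid R n f M) k - a k) + nc (grid_coef N k)).
have T2 (S : {fset 'rV[int]_n}) : \sum_(k <- S) t2 k <= (e + e) + e.
  apply: ler_sum_split => [k||T]; first by rewrite mulr_ge0 ?addr_ge0 ?nc_ge0.
    rewrite /t2; under eq_bigr do rewrite mulrDr.
    rewrite big_split lerD//=.
      apply: (@le_trans _ _ (V * (e / (V + 1)))); last first.
        by rewrite mulrA ler_pdivrMr ?ltr_wpDl// mulrC ler_wpM2l ?(ltW e0)// lerDl.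
      apply: (@le_trans _ _ ((\sum_(k <- S2) cw k) * (e / (V + 1)))); last first.
        by rewrite ler_wpM2r ?(ltW eV).
      rewrite mulr_suml big_seq [leRHS]big_seq; apply: ler_sum => k kS.
      by rewrite ler_wpM2l// alia.
    (* Cauchy-Schwarz, then Bessel on the grid, turns the energy hypothesis into a bound for the
       [near] part. *)
    apply: (sum_mul_le X0 e0); first exact: sum_kcoef_weight_sqr.
    rewrite (le_trans (grid_bessel _ M0 sep))// (le_trans _ En)//.
    rewrite ler_wpM2l ?invr_ge0 ?exprn_ge0// [leRHS]big_mkcond; apply: ler_sum => s _.
    by rewrite /N; case: ifP => // _; rewrite nc0 expr0n.
  apply: (@le_trans _ _ ((3 * B) * (e / (3 * B + 1)))); last first.
    rewrite mulrA ler_pdivrMr ?ltr_wpDl ?mulr_ge0// mulrC ler_wpM2l ?(ltW e0)//.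
    by rewrite lerDl.
  apply: (@le_trans _ _ ((3 * B) * \sum_(k <- T | k \notin S2) cw k)); last first.
    by rewrite ler_wpM2l ?mulr_ge0.
  rewrite mulr_sumr; apply: ler_sum => k _; rewrite mulrC /t2 ler_wpM2l//.
  have := ncB (grid_coef (@on_grid R n f M) k) (a k).
  by have := Nb k; have := fhb k; have := ab k; lra.
move=> S; apply: (@le_trans _ _ (\sum_(k <- S)
    (nc (a k) * weight alpha k * nc (kcoef R p q k - 1) + t2 k))).
  apply: ler_sum => k _; rewrite farE.
  set c := kcoef R p q k; set fh := grid_coef _ k; set nh := grid_coef N k.
  have -> : a k - c * (fh - nh) = - (a k * (c - 1)) - c * (fh - a k) + c * nh by ring.
  have h : nc (- (a k * (c - 1)) - c * (fh - a k) + c * nh) <=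
     nc (a k) * nc (c - 1) + nc c * nc (fh - a k) + nc c * nc nh.
    by rewrite (le_trans (ncD _ _))// ncM lerD2r (le_trans (ncB _ _))// ncN !ncM.
  apply: le_trans (ler_wpM2r (w0 k) h) _.
  rewrite le_eqVlt; apply/orP; left; apply/eqP; rewrite /t2 /cw -/c -/fh -/nh.
  ring.
rewrite big_split /=; have := T1 S; have := T2 S; lra.
Qed.

End Approximation.

(** * Grid points and energy near [E] *)

Section Energy.
Context (R : realType) (n : nat).
Implicit Types (M q : nat) (E : set (torus R n)) (t y : torus R n).

Definition near_grid E (r : R) M : pred {ffun 'I_n -> 'I_M} :=
  fun s => `[< exists2 y, E y & mdist (tclass (gridpt R s)) y < r >].

Lemma mdist_lift_tclass (x y : 'rV[R]_n) (e : R) :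
  mdist (tclass x) (tclass y) < e -> exists l, enorm (x - y + latt R l) < e.
Proof.
move=> xye; have [a xa] := repr_tclass x; have [b yb] := repr_tclass y.
have d0 : 0 < e - mdist (tclass x) (tclass y) by rewrite subr_gt0.
have [l] := mdist_lift (tclass x) (tclass y) d0.
rewrite [X in _ < X]addrC subrK xa yb => h; exists (l + a - b).
rewrite !lattD lattN.
rewrite (_ : x - y + _ = x + latt R a - (y + latt R b) + latt R l)//.
by rewrite opprD; apply/rowP => j; rewrite !mxE; ring.
Qed.

(** Points of the ball lie within [2 r] of one of them, [s0]. As the mesh is [2 pi / M], index
    displacements modulo [M] are at most [D <= r M], leaving [2 D + 1 <= 3 r M] choices per
    coordinate. *)
Lemma card_grid_ball y (r : R) M : (0 < M)%N -> 0 < r -> 1 <= r * M%:R ->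
  #|[pred s : {ffun 'I_n -> 'I_M} | mdist (tclass (gridpt R s)) y < r]|%:R
  <= (3 * r * M%:R) ^+ n.
Proof.
move=> M0 r0 rM; set B := [pred s | _].
have MR : (0 : R) < M%:R by rewrite ltr0n.
have rM0 : 0 <= r * M%:R by rewrite mulr_ge0// ltW.
have [s0 s0B|B0] := pickP B; last first.
  by rewrite eq_card0// exprn_ge0// mulr_ge0// mulr_ge0// ltW.
pose D := Num.truncn (r * M%:R).
have DrM : D%:R <= r * M%:R by have /andP[] := truncn_itv rM0.
(* The term [D * M.-1] stands for [- D] modulo [M], so that [g j] encodes a displacement in
   [[-D, D]]. *)
pose phi (g : {ffun 'I_n -> 'I_(2 * D).+1}) : {ffun 'I_n -> 'I_M} :=
  [ffun j => Ordinal (ltn_pmod (s0 j + g j + D * M.-1) M0)].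
have Bphi : (#|B| <= #|codom phi|)%N.
  apply: subset_leq_card; apply/fintype.subsetP => s sB.
  have ss0 : mdist (tclass (gridpt R s)) (tclass (gridpt R s0)) < 2 * r.
    rewrite (le_lt_trans (metric_triangle _ y _))// [mdist y _]metric_sym.
    by have : mdist (tclass (gridpt R s0)) y < r := s0B;
      have : mdist (tclass (gridpt R s)) y < r := sB; lra.
  have [l hl] := mdist_lift_tclass ss0.
  pose d j : int := (s j)%:Z - (s0 j)%:Z + M%:Z * l 0 j.
  have dD j : (`|d j| <= D)%N.
    have := le_lt_trans (enorm_coord _ j) hl.
    have -> : (gridpt R s - gridpt R s0 + latt R l) 0 j = 2 * pi / M%:R * (d j)%:~R.
      rewrite /d rmorphD rmorphB rmorphM /= -!pmulrn /latt !mxE.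
      by move: (pi : R) => P; field; rewrite gt_eqF.
    rewrite normrM ger0_norm; last by rewrite divr_ge0 ?mulr_ge0 ?pi_ge0// ltW.
    rewrite -intr_norm -abszE => h.
    rewrite truncn_ge_nat// -[_%:R]/((`|d j|%N%:Z)%:~R).
    have p2 := pi_ge2 R.
    have := h; rewrite mulrAC ltr_pdivrMr// => h'.
    have z0 : (0 : R) <= (`|d j|%N%:Z)%:~R by rewrite ler0z.
    by move: h'; move: (pi : R) (`|d j|%N%:Z)%:~R z0 p2 => P z z0 p2 h'; nra.
  apply/codomP; exists [ffun j => inord `|(d j + D%:Z)%R|%N].
  apply/ffunP => j; apply/val_inj; rewrite !ffunE /=.
  have dDj := dD j; rewrite inordK; last by lia.
  have e : (s0 j + `|(d j + D%:Z)%R| + D * M.-1)%N%:Z = (s j)%:Z + M%:Z * (l 0 j + D%:Z).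
    rewrite !PoszD gez0_abs; last by lia.
    have -> : (D * M.-1)%N%:Z = M%:Z * D%:Z - D%:Z.
      by rewrite PoszM -subn1 -subzn// mulrBr mulr1 mulrC.
    by rewrite /d; ring.
  apply/eqP; rewrite -eqz_nat -modz_nat e mulrC addrC modzMDl modz_small//.
  by rewrite /= ltz_nat ltn_ord.
have card_le : (#|B| <= (2 * D).+1 ^ n)%N.
  apply: leq_trans Bphi _; rewrite (leq_trans (leq_image_card _ _))//.
  by rewrite card_ffun !card_ord.
apply: (@le_trans _ _ (((2 * D).+1 ^ n)%N%:R)); first by rewrite ler_nat.
rewrite natrX lerXn2r ?nnegrE ?mulr_ge0 ?(ltW r0)//.
rewrite -natr1 natrM; lra.
Qed.

Lemma near_bound E (f : torus R n -> R[i]) (A m r : R) t : 0 <= A -> 0 < m ->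
  (forall t y, E y -> nc (f t) <= A * mdist t y `^ m) ->
  (exists2 y, E y & mdist t y < r) -> nc (f t) <= A * r `^ m.
Proof.
move=> A0 m0 fE [y Ey ty]; rewrite (le_trans (fE t y Ey))// ler_wpM2l//.
by apply: ge0_ler_powR; rewrite ?nnegrE ?mdist_ge0 ?(ltW m0) ?ltW// (le_lt_trans _ ty)// mdist_ge0.
Qed.

Lemma energy_le_card E (f : torus R n -> R[i]) (A m r : R) M
    (P : pred {ffun 'I_n -> 'I_M}) :
  0 <= A -> 0 < m -> (forall t y, E y -> nc (f t) <= A * mdist t y `^ m) ->
  {subset P <= @near_grid E r M} ->
  \sum_(s | P s) nc (on_grid f s) ^+ 2 <= #|P|%:R * (A * r `^ m) ^+ 2.
Proof.
move=> A0 m0 fE Pn; rewrite mulr_natl -sumr_const; apply: ler_sum => s Ps.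
rewrite lerXn2r ?nnegrE ?nc_ge0 ?mulr_ge0 ?powR_ge0//.
by apply: near_bound fE _ => //; have /asboolP := Pn s Ps.
Qed.

End Energy.

(** * Smallness of the energy at suitable scales *)

Section EnergyDecay.
Context (R : realType) (n : nat).
Implicit Types (M q : nat) (E : set (torus R n)) (t y : torus R n).

(* The scale q may depend on M, but only ranges over a finite set fixed before
   M: this is what the pigeonhole argument yields. *)
Definition energy_small E (f : torus R n -> R[i]) (D beta : R) :=
  forall (eta : R) (q1 : nat), 0 < eta -> exists2 qs : seq nat,
    {in qs, forall q, (q1 < q)%N} &
    exists M0, forall M, (M0 <= M)%N -> (0 < M)%N -> exists2 q, q \in qs &
      (M%:R ^+ n)^-1 *
        \sum_(s | @near_grid R n E (2 * (D / q%:R)) M s) nc (on_grid f s) ^+ 2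
      <= eta / q%:R `^ beta.

Lemma card_le_sum (T I : finType) (P : pred T) (B : I -> pred T) :
  (forall s, P s -> exists i, B i s) -> (#|P| <= \sum_i #|B i|)%N.
Proof.
move=> PB; rewrite -sum1_card.
under [leqRHS]eq_bigr do rewrite -sum1_card big_mkcond.
rewrite exchange_big /= [leqLHS]big_mkcond; apply: leq_sum => s _.
case: ifP => // sP; have [i Bi] := PB s sP.
by rewrite (bigD1 i)//= unfold_in Bi.
Qed.

(** [sup] is 0 on a set without a supremum, so a positive diameter forces [E] to be nonempty with
    bounded distances. *)
Lemma diam_gt0_center E : 0 < diam E ->
  exists2 y, E y & forall z, E z -> mdist z y <= diam E.
Proof.
move=> d0; have hs : has_sup [set mdist x y | x in E & y in E].
  by apply: contrapT => /sup_out; rewrite -/(diam E) => dE; rewrite dE ltxx in d0.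
have [[_ [x Ex [y Ey _]]] _] := hs.
exists y => // z Ez; apply: sup_upper_bound => //.
by exists z => //; exists y.
Qed.

Lemma sumr_ord_const (Q : nat) (x : R) : \sum_(i < Q) x = Q%:R * x.
Proof. by rewrite sumr_const card_ord mulr_natl. Qed.

Lemma powR_sqr (x r : R) : (x `^ r) ^+ 2 = x `^ (2 * r).
Proof. by rewrite -powR_mulrn ?powR_ge0// -powRrM mulrC. Qed.

(** At scale [d] about [d^(-c)] balls of radius [3 d] cover the [2 d]-neighbourhood of [E]. Each
    holds a fraction [O(d^n)] of the grid, and [|f| <= A (2 d)^m] there, so the energy is
    [O(d^(2 m + n - c))], which is [O(d^(beta + kappa))] with [kappa > 0]. *)
Lemma energy_covering E (f : torus R n -> R[i]) (A m c alpha D : R) :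
  0 < A -> 0 < m -> 0 < c -> 0 < D ->
  (forall t y, E y -> nc (f t) <= A * mdist t y `^ m) ->
  balanced_covers E c -> c / 2 + alpha < m ->
  energy_small E f D (2 * alpha + n%:R).
Proof.
move=> A0 m0 c0 D0 fE [N [P [N0 P0 [e /= e0 He]]]] cam eta q1 eta0.
set beta := 2 * alpha + n%:R; pose kappa := 2 * m - c - 2 * alpha.
have k0 : 0 < kappa by rewrite /kappa; lra.
pose C := N * P `^ c * 9 ^+ n * (A ^+ 2 * 2 `^ (2 * m)) * D `^ beta.
have C0 : 0 < C by rewrite !mulr_gt0 ?powR_gt0 ?exprn_gt0.
(* Chosen so that [d <= rho] implies [C * d^kappa <= eta]. *)
pose rho := (eta / C) `^ kappa^-1.
have rho0 : 0 < rho by rewrite powR_gt0 ?divr_gt0.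
pose q := (q1 + Num.truncn (D / e + D / rho)).+1.
have qR : (0 : R) < q%:R by rewrite ltr0n.
pose d := D / q%:R; have d0 : 0 < d by rewrite divr_gt0.
have qbig : D / e + D / rho < q%:R.
  by rewrite (lt_le_trans (truncnS_gt _))// ler_nat ltnS leq_addl.
have De0 : 0 < D / e by rewrite divr_gt0.
have Dr0 : 0 < D / rho by rewrite divr_gt0.
have de : d < e.
  by rewrite ltr_pdivrMr// mulrC -ltr_pdivrMr// (lt_trans _ qbig)// ltrDl.
have drho : d <= rho.
  rewrite ler_pdivrMr// mulrC -ler_pdivrMr// (le_trans _ (ltW qbig))//.
  by rewrite lerDr ltW.
have [Q [b [_ Eb db Sb]]] : exists Q (b : 'I_Q -> set (torus R n)),
    [/\ trivIset [set: 'I_Q] b, E `<=` \bigcup_j b j,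
      forall j, d / P < diam (b j) < d & \sum_(j < Q) diam (b j) `^ c <= N].
  by apply: He => //=; rewrite sub0r normrN gtr0_norm.
exists [:: q]; first by move=> q'; rewrite inE => /eqP ->; rewrite ltnS leq_addr.
exists (Num.truncn (3 * d)^-1).+1 => M MM M0; exists q; first by rewrite inE.
rewrite -/d; have MR : (0 : R) < M%:R by rewrite ltr0n.
have d3 : 0 < 3 * d by rewrite mulr_gt0.
have dM : 1 <= 3 * d * M%:R.
  rewrite mulrC -ler_pdivrMr// mul1r (le_trans (ltW (truncnS_gt _)))//.
  by rewrite ler_nat.
have dP0 : 0 < d / P by rewrite divr_gt0.
have /choice[y yP] : forall i, exists y,
    b i y /\ forall z, b i z -> mdist z y <= diam (b i).
  move=> i; have /andP[di _] := db i.
  by have [y by_ yz] := diam_gt0_center (lt_trans dP0 di); exists y.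
set near := @near_grid R n E (2 * d) M.
have cardn : (#|near|%:R : R) <= Q%:R * (3 * (3 * d) * M%:R) ^+ n.
  apply: (@le_trans _ _ (\sum_(i < Q)
      #|[pred s : {ffun 'I_n -> 'I_M} | (mdist (tclass (gridpt R s)) (y i) < 3 * d)%R]|)%N%:R).
    rewrite ler_nat; apply: card_le_sum => s /asboolP[z Ez sz].
    have [i _ biz] := Eb z Ez; exists i => /=.
    rewrite (le_lt_trans (metric_triangle _ z _))//.
    have := (yP i).2 z biz; have /andP[_] := db i; lra.
  rewrite natr_sum -(sumr_ord_const Q).
  by apply: ler_sum => i _; exact: card_grid_ball.
(* The lower bound on the diameters turns the bound on the sum into a bound on the number of
   sets. *)
have QN : Q%:R <= N * (P / d) `^ c.
  have : Q%:R * (d / P) `^ c <= N.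
    rewrite (le_trans _ Sb)// -(sumr_ord_const Q).
    apply: ler_sum => i _; have /andP[di _] := db i.
    apply: ge0_ler_powR; rewrite ?nnegrE ?(ltW c0) ?(ltW di) ?(ltW dP0)//.
    by rewrite (le_trans (ltW dP0)) ?ltW.
  rewrite -ler_pdivlMr ?powR_gt0// => /le_trans; apply.
  rewrite ler_wpM2l ?(ltW N0)//.
  have -> // : (P / d) `^ c = ((d / P) `^ c)^-1.
  by rewrite -[P / d]invf_div -[(d / P)^-1]powR_inv1 ?(ltW dP0)// -powRrM mulN1r powRN.
have En := energy_le_card (ltW A0) m0 fE (fun s (h : s \in near) => h).
apply: (@le_trans _ _ ((M%:R ^+ n)^-1 * (Q%:R * (3 * (3 * d) * M%:R) ^+ n *
    (A * (2 * d) `^ m) ^+ 2))).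
  rewrite ler_wpM2l ?invr_ge0 ?exprn_ge0// (le_trans En)// ler_wpM2r ?sqr_ge0//.
apply: (@le_trans _ _ (N * (P / d) `^ c * (9 * d) ^+ n * (A * (2 * d) `^ m) ^+ 2)).
  have -> : (M%:R ^+ n)^-1 * (Q%:R * (3 * (3 * d) * M%:R) ^+ n *
      (A * (2 * d) `^ m) ^+ 2) = Q%:R * (9 * d) ^+ n * (A * (2 * d) `^ m) ^+ 2.
    have -> : 3 * (3 * d) * M%:R = 9 * d * M%:R by ring.
    rewrite [(9 * d * _) ^+ n]exprMn; set u := (9 * d) ^+ n; set v := _ ^+ 2.
    by field; rewrite expf_neq0// gt_eqF.
  by rewrite ler_wpM2r ?sqr_ge0// ler_wpM2r// exprn_ge0// mulr_ge0// ltW.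
have -> : N * (P / d) `^ c * (9 * d) ^+ n * (A * (2 * d) `^ m) ^+ 2 =
    C * d `^ kappa / q%:R `^ beta.
  have -> : (P / d) `^ c = P `^ c * d `^ (- c).
    by rewrite powRM ?invr_ge0 ?(ltW P0) ?(ltW d0)// -powR_inv1 ?(ltW d0)// -powRrM mulN1r.
  rewrite [(A * _) ^+ 2]exprMn powR_sqr powRM ?(ltW d0)// exprMn.
  have -> : d ^+ n = d `^ n%:R by rewrite powR_mulrn// ltW.
  have dd x z : d `^ x * d `^ z = d `^ (x + z).
    by rewrite powRD// (gt_eqF d0) implybT.
  have -> : C * d `^ kappa / q%:R `^ beta =
     N * P `^ c * 9 ^+ n * (A ^+ 2 * 2 `^ (2 * m)) * (d `^ beta * d `^ kappa).
    rewrite /C; have -> : D `^ beta = d `^ beta * q%:R `^ beta.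
      by rewrite -powRM ?(ltW d0)// /d divfK// gt_eqF.
    by field; rewrite gt_eqF// powR_gt0.
  transitivity (N * P `^ c * 9 ^+ n * (A ^+ 2 * 2 `^ (2 * m)) *
    (d `^ (- c) * d `^ n%:R * d `^ (2 * m))); first by ring.
  by rewrite !dd; congr (_ * _ `^ _); rewrite /beta /kappa; ring.
rewrite ler_wpM2r ?invr_ge0 ?powR_ge0// mulrC -ler_pdivlMr//.
apply: (@le_trans _ _ (rho `^ kappa)).
  by apply: ge0_ler_powR; rewrite ?nnegrE ?(ltW k0) ?(ltW d0) ?(ltW rho0).
by rewrite /rho -powRrM mulVf ?gt_eqF// powRr1// divr_ge0// ltW.
Qed.

Lemma pigeonhole_disjoint (T : finType) (J : nat) (B : 'I_J -> pred T) :
  (0 < J)%N -> (forall s (i j : 'I_J), (i < j)%N -> B i s -> B j s -> False) ->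
  exists i, (J * #|B i| <= #|T|)%N.
Proof.
move=> J0 dis; have S1 : (\sum_i #|B i| <= #|T|)%N.
  rewrite -sum1_card; under eq_bigr do rewrite -sum1_card big_mkcond.
  rewrite exchange_big /=; apply: leq_sum => s _.
  have [i Bi|noB] := pickP (fun i => B i s); last first.
    by rewrite big1// => i _; rewrite unfold_in noB.
  rewrite (bigD1 i)//= big1 ?addn0; first by case: ifP.
  move=> j ji; case: ifP => // Bj; exfalso.
  case: (ltngtP i j) => [ij|ij|/val_inj ij]; last by rewrite ij eqxx in ji.
    exact: dis ij Bi Bj.
  exact: dis ij Bj Bi.
apply: contrapT => /forallNP H.
have : (J * #|T|.+1 <= J * \sum_i #|B i|)%N.
  rewrite big_distrr /= -[J in leqLHS]card_ord -sum_nat_const.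
  by apply: leq_sum => i _; rewrite ltnNge; apply/negP; exact: H.
by rewrite leq_pmul2l// leqNgt ltnS S1.
Qed.

(** At scale [d j], points within [u * d j] of [E] are handled by the smallness of [f] alone, with
    the trivial count of the whole grid. The remaining bands are disjoint for different [j], so one
    of the [J] bands holds at most a fraction [1 / J] of the grid. Each part contributes at most
    half of [eta]. *)
Lemma energy_pigeonhole E (f : torus R n -> R[i]) (A m D : R) :
  0 < A -> 0 < m -> 0 < D ->
  (forall t y, E y -> nc (f t) <= A * mdist t y `^ m) ->
  energy_small E f D (2 * m).
Proof.
move=> A0 m0 D0 fE eta q1 eta0; set beta := 2 * m.
have b0 : 0 < beta by rewrite mulr_gt0.
pose C := A ^+ 2 * D `^ beta.
have C0 : 0 < C by rewrite mulr_gt0 ?exprn_gt0 ?powR_gt0.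
pose u := (eta / 2 / C) `^ beta^-1.
have u0 : 0 < u by rewrite powR_gt0 ?divr_gt0.
have uE : C * u `^ beta = eta / 2.
  rewrite -powRrM mulVf ?gt_eqF// powRr1 ?divr_ge0 ?ltW// ?divr_gt0//.
  by rewrite mulrC divfK// gt_eqF.
(* The ratio of successive scales; [2 / T <= u] makes the bands disjoint. *)
pose T := (Num.truncn (2 / u)).+1.
have TR : (0 : R) < T%:R by rewrite ltr0n.
have uT : 2 / T%:R <= u.
  by rewrite ler_pdivrMr// mulrC -ler_pdivrMr//; exact: ltW (truncnS_gt _).
pose J := (Num.truncn (C * 2 `^ beta / (eta / 2))).+1.
have JR : (0 : R) < J%:R by rewrite ltr0n.
have JE : C * 2 `^ beta / J%:R <= eta / 2.
  rewrite ler_pdivrMr// [leRHS]mulrC -ler_pdivrMr ?divr_gt0//.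
  exact: ltW (truncnS_gt _).
pose q (j : nat) := (q1.+1 * T ^ j)%N.
have q0 j : (q1 < q j)%N by rewrite leq_pmulr// expn_gt0.
exists [seq q j | j <- iota 0 J]; first by move=> _ /mapP[j _ ->].
exists 0%N => M _ M0; have MR : (0 : R) < M%:R by rewrite ltr0n.
pose d j : R := D / (q j)%:R.
have qR j : (0 : R) < (q j)%:R by rewrite ltr0n (leq_ltn_trans _ (q0 j)).
have d0 j : 0 < d j by rewrite divr_gt0.
have dd i j : (i < j)%N -> 2 * d j <= u * d i.
  move=> ij; apply: (@le_trans _ _ (2 / T%:R * d i)); last by rewrite ler_wpM2r// ltW.
  rewrite -mulrA ler_wpM2l// /d [leRHS]mulrCA.
  rewrite ler_wpM2l ?(ltW D0)// -invfM lef_pV2 ?posrE ?mulr_gt0//.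
  rewrite -natrM ler_nat /q mulnCA leq_mul2l /= -expnS.
  by rewrite leq_pexp2l.
pose nr r := @near_grid R n E r M.
pose B (j : 'I_J) : pred {ffun 'I_n -> 'I_M} :=
  [pred s | nr (2 * d j) s && ~~ nr (u * d j) s].
have [j cardB] : exists j, (J * #|B j| <= #|{: {ffun 'I_n -> 'I_M}}|)%N.
  apply: pigeonhole_disjoint => // s i j ij /andP[_ /negP Ni] /andP[Nj _]; apply: Ni.
  have /asboolP[z Ez zs] := Nj; apply/asboolP; exists z => //.
  by rewrite (lt_le_trans zs)// dd.
exists (q j); first by apply: map_f; rewrite mem_iota add0n ltn_ord.
rewrite -/(d j) -/(nr (2 * d j)).
rewrite (bigID (nr (u * d j)))/=.
have V0 : 0 < (M%:R : R) ^+ n by rewrite exprn_gt0.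
(* Serves both parts: [r = u], [N = 1] for the inner one, and [r = 2], [N = 1 / J] for the band. *)
have ball_energy (P : pred {ffun 'I_n -> 'I_M}) r N : 0 < r ->
    {subset P <= nr (r * d j)} -> #|P|%:R <= N * M%:R ^+ n ->
    (M%:R ^+ n)^-1 * \sum_(s | P s) nc (on_grid f s) ^+ 2 <=
      N * (C * r `^ beta) / (q j)%:R `^ beta.
  move=> r0 Pn PN; rewrite mulrC ler_pdivrMr//.
  rewrite (le_trans (energy_le_card (ltW A0) m0 fE Pn))//.
  rewrite (le_trans (ler_wpM2r (sqr_ge0 _) PN))// le_eqVlt; apply/orP; left; apply/eqP.
  rewrite exprMn powR_sqr -/beta powRM ?(ltW r0) ?(ltW (d0 _))// /C.
  have -> : D `^ beta = d j `^ beta * (q j)%:R `^ beta.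
    by rewrite -powRM ?(ltW (d0 _))// /d divfK// gt_eqF.
  by field; rewrite gt_eqF// powR_gt0.
rewrite mulrDr.
apply: (@le_trans _ _ (1 * (C * u `^ beta) / (q j)%:R `^ beta +
   J%:R^-1 * (C * 2 `^ beta) / (q j)%:R `^ beta)).
  apply: lerD; apply: ball_energy => //.
  - by move=> s /andP[].
  - by rewrite mul1r -natrX -card_grid ler_nat max_card.
  - by move=> s /andP[].
  - rewrite [leRHS]mulrC ler_pdivlMr// -natrX -natrM ler_nat mulnC -card_grid.
    exact: cardB.
rewrite -mulrDl ler_wpM2r ?invr_ge0 ?powR_ge0// mul1r uE mulrC; lra.
Qed.

End EnergyDecay.

(** * Choice of the parameters and conclusion *)

Unset Implicit Arguments.

Theorem theorem3 (R : realType) (n : nat) (alpha c A m : R)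
    (E : set (torus R n)) (f : torus R n -> R[i]) :
  0 < alpha ->
  closed E ->
  bh_dim E = c%:E ->
  I_ideal alpha E f ->
  0 < A -> 0 < m ->
  (forall x, ((Normc.normc (f x))%:E <= A%:E * (dist_to x E) `^ m)%E) ->
  c / 2 + alpha < m \/
    (m = c / 2 + alpha /\ c / 2 + alpha = n%:R / 2 + alpha) ->
  J_ideal alpha E f.
Proof.
move=> a0 _ bhE [[fcont [a fa afin]] _] A0 m0 fA cm.
(* Pointwise form of the growth condition; it is vacuous for empty [E], where [dist_to] is
   infinite. *)
have fE t y : E y -> nc (f t) <= A * mdist t y `^ m.
  move=> Ey; rewrite -lee_fin (le_trans (fA t))// EFinM -poweR_EFin.
  rewrite lee_pmul2l ?lte_fin//.
  have ty : (dist_to t E <= (mdist t y)%:E)%E by apply: ereal_inf_lbound; exists y.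
  have t0 : (0 <= dist_to t E)%E.
    by apply: le_ereal_inf_tmp => _ [z _ <-]; rewrite lee_fin mdist_ge0.
  apply: gt0_ler_poweR => //; first exact: ltW.
  - by rewrite in_itv/= t0 leey.
  - by rewrite in_itv/= lee_fin mdist_ge0 leey.
pose p := (Num.truncn (alpha + 2)).+1.
have ap : alpha + 2 <= p%:R by exact: ltW (truncnS_gt _).
have p1 : (1 < p)%N by rewrite -(ltr_nat R); lra.
have pR : (0 : R) < p%:R by rewrite ltr0n.
(* [D / q] is [n + 1] times the side of the kernel's support, strictly more than the [n] sides
   required by [approximant_vanish]. *)
pose D : R := n.+1%:R * (2 * pi * p%:R).
have D0 : 0 < D by rewrite !mulr_gt0 ?pi_gt0.
have small : energy_small E f D (2 * alpha + n%:R).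
  case: cm => [cm|[mE nE]]; last first.
    have -> : 2 * alpha + n%:R = 2 * m by rewrite mE nE; field.
    exact: energy_pigeonhole fE.
  (* The infimum [c] may not be attained; this margin provides an admissible [c'] with
     [c' / 2 + alpha < m]. *)
  have e0 : 0 < 2 * (m - (c / 2 + alpha)) by rewrite mulr_gt0// subr_gt0.
  have [|_ [c' [c'0 bc] <-]] := @lb_ereal_inf_adherent R
      [set c%:E | c in [set c | 0 < c /\ balanced_covers E c]] _ e0.
    by rewrite -/(bh_dim E) bhE.
  rewrite -/(bh_dim E) bhE -EFinD lte_fin => cc'.
  by apply: (energy_covering A0 m0 c'0 D0 fE bc); lra.
have [B aB] := weighted_l1_finite afin.
split; first by split=> //; exists a.
move=> eps eps0; pose e := eps / 6; have e0 : 0 < e by rewrite divr_gt0.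
have [q0 Hq0] := approximant_error (ltW a0) ap fa aB e0.
(* [energy_scale] is [C] times [q^(2 alpha + n)], so [energy_small] with [eta = e^2 / C] yields the
   bound asked for by [approximant_error]. *)
pose C : R := (2 ^+ (p * n)) ^+ 2 * 3 ^+ n.
have C0 : 0 < C by rewrite mulr_gt0 ?exprn_gt0.
have CE q : (0 < q)%N -> energy_scale n alpha p q = C * q%:R `^ (2 * alpha + n%:R).
  move=> qpos; rewrite /energy_scale !exprMn powR_sqr powRD; last first.
    by rewrite pnatr_eq0 -lt0n qpos implybT.
  by rewrite powR_mulrn// /C; ring.
have [qs qsq0 [M1 HM1]] := small (e ^+ 2 / C) q0 (divr_gt0 (exprn_gt0 2 e0) C0).
have /choice[M2 HM2] : forall q, exists M0, q \in qs ->
    forall M, (M0 <= M)%N -> (0 < M)%N ->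
    forall near : pred {ffun 'I_n -> 'I_M},
    (M%:R ^+ n)^-1 * \sum_(s | near s) nc (on_grid f s) ^+ 2 <=
      e ^+ 2 / energy_scale n alpha p q ->
    forall S : {fset 'rV[int]_n},
    \sum_(k <- S) nc (a k - kcoef R p q k * grid_coef (far_part f near) k)
      * weight alpha k <= 5 * e.
  move=> q; have [qqs|] := boolP (q \in qs); last by exists 0%N.
  have qq0 := qsq0 _ qqs.
  have [M0 HM0] := Hq0 q (ltnW qq0) (leq_ltn_trans (leq0n _) qq0).
  by exists M0.
(* The scale [q] is known only after [M], so [M] has to exceed the thresholds of all candidates in
   the finite list [qs]. *)
pose M := (M1 + \sum_(q <- qs) M2 q).+1.
have [|q qqs En] := HM1 M _ isT; first by rewrite leqW// leq_addr.
have qpos : (0 < q)%N by exact: leq_ltn_trans (qsq0 _ qqs).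
have qR : (0 : R) < q%:R by rewrite ltr0n.
pose d := D / q%:R; have d0 : 0 < d by rewrite divr_gt0.
set near := @near_grid R n E (2 * (D / q%:R)) M in En.
have M2M : (M2 q <= M)%N.
  by rewrite leqW// (leq_trans _ (leq_addl _ _))// (big_rem q)//= leq_addr.
have err := HM2 q qqs M M2M isT near.
have En' : (M%:R ^+ n)^-1 * \sum_(s | near s) nc (on_grid f s) ^+ 2 <=
    e ^+ 2 / energy_scale n alpha p q.
  by rewrite CE// invfM mulrA.
have {}err := err En'.
pose b k := kcoef R p q k * grid_coef (far_part f near) k.
have bB (S : {fset 'rV[int]_n}) : \sum_(k <- S) nc (b k) * weight alpha k <= B + 5 * e.
  apply: (@le_trans _ _ (\sum_(k <- S) (nc (a k) * weight alpha k +
      nc (a k - b k) * weight alpha k))).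
    apply: ler_sum => k _; rewrite -mulrDl ler_wpM2r ?weight_ge0//.
    rewrite (_ : b k = a k - (a k - b k)); last by ring.
    by rewrite (le_trans (ncB _ _))// (_ : a k - (a k - (a k - b k)) = a k - b k)//; ring.
  by rewrite big_split /= lerD.
have bB' (S : {fset 'rV[int]_n}) : \sum_(k <- S) nc (b k) <= B + 5 * e.
  rewrite (le_trans _ (bB S))//; apply: ler_sum => k _.
  by rewrite ler_peMr ?nc_ge0// weight_ge1// ltW.
have [g gb] := fourier_series_exists bB'.
exists g; last first.
  rewrite /A_norm (fourier_coefE (fourier_seriesB fa gb)).
  apply: (@le_lt_trans _ _ (5 * e)%:E); first exact/weighted_l1_le.
  by rewrite lte_fin /e; lra.
split.
  split; first exact: fourier_series_continuous gb bB'.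
  exists b => //; apply: (@le_lt_trans _ _ (B + 5 * e)%:E); last exact: ltry.
  exact/weighted_l1_le.
(* A grid point where the far part is nonzero is at distance at least [2 d] from [E], hence more
   than [d] from any [t] in this neighbourhood, so the kernel does not reach [t]. *)
exists (\bigcup_(y in E) (ball y d)^°); split.
- by apply: bigcup_open => y _; exact: open_interior.
- by move=> y Ey; exists y => //; apply: nbhsx_ballx.
move=> t [y Ey /interior_subset]; rewrite ballEmdist /= => yt.
apply: (approximant_vanish qpos p1 _ gb) => // s.
rewrite /far_part; case: ifP => [_|/negP ns _]; first by rewrite eqxx.
have h : 2 * d <= mdist (tclass (gridpt R s)) y.
  by rewrite leNgt; apply/negP => sy; apply: ns; apply/asboolP; exists y.
have := metric_triangle (tclass (gridpt R s)) t y.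
rewrite [mdist t y]metric_sym [mdist _ t]metric_sym.
have : n%:R * (2 * pi * p%:R / q%:R) < d.
  rewrite /d /D mulrA ltr_pM2r ?invr_gt0// ltr_pM2r ?mulr_gt0 ?pi_gt0//.
  by rewrite ltr_nat.
lra.
Qed.
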